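(* Let $n\in\mathbb{N}$, let $0\le\gamma<1$, let $b\ge c>0$ be real numbers, and let $\lambda,\mu\ge 0$ be real with $1\le\lambda+\mu<2$, $0\le\alpha\le\frac{6}{\lambda+4}$, $0\le\beta\le\frac{6}{\mu+4}$. Suppose that: (1) $2(2-\gamma)(c+n-2)\le b+n-2$; (2) $(2+\alpha)^{\lambda}(2+\beta)^{\mu}(3-\gamma)(3-2\gamma)(c+n-3)\le 2(2-\gamma)(b+n-3)$; (3) $(k+1+\alpha)^{\lambda}(k+1+\beta)^{\mu}(k+2-\gamma)(k+2-2\gamma)(c+n-k-2)\le(k+\alpha)^{\lambda}(k+\beta)^{\mu}(k+1-\gamma)(k+1)(b+n-k-2)$ for $2\le k\le n-3$; (4) $(n-1+\alpha)^{\lambda}(n-1+\beta)^{\mu}(n-\gamma)(n-2\gamma)\,c\le(n-2+\alpha)^{\lambda}(n-2+\beta)^{\mu}(n-1-\gamma)(n-1)(1+b-c)$. Then the polynomial $s_n^{(b-1,c)}(z)$ is prestarlike of order $\gamma$.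
   Context: $\mathbb{D}=\{z\in\mathbb{C}:|z|<1\}$. $\mathcal{A}_0$ is the class of analytic functions on $\mathbb{D}$ with $f(0)=0$ and $f'(0)=1$. For $0\le\gamma<1$, $\mathcal{S}^{\ast}(\gamma)$ is the class of $f\in\mathcal{A}_0$ with $\mathrm{Re}\left(\frac{zf'(z)}{f(z)}\right)>\gamma$ for all $z\in\mathbb{D}$. The Hadamard product (convolution) of $f(z)=\sum_{k\ge0}a_kz^k$ and $g(z)=\sum_{k\ge0}b_kz^k$ is $(f\ast g)(z)=\sum_{k\ge0}a_kb_kz^k$. A function $f\in\mathcal{A}_0$ is prestarlike of order $\gamma$ if $\frac{z}{(1-z)^{2-2\gamma}}\ast f(z)\in\mathcal{S}^{\ast}(\gamma)$. For real $b,c$ with $b+1>c>0$, set $B_0=1$ and $B_k=\frac{1+b-c}{b}\frac{(b)_k}{(c)_k}$ for $k\ge1$, where $(x)_0=1$ and $(x)_k=x(x+1)\cdots(x+k-1)$; for $n\in\mathbb{N}$, $s_n^{(b-1,c)}(z)=z+\sum_{k=2}^{n}\frac{B_{n-k}}{B_{n-1}}z^k$. *)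

(* Defs.v *)
From Stdlib Require Import Reals.
From Coquelicot Require Import Coquelicot.

Open Scope R_scope.

(* Real power of a nonnegative base, with 0^0 = 1 and 0^y = 0 for y > 0.
   [Rpower] alone would give [Rpower 0 y = 1] for every [y]. *)
Definition rpow (x y : R) : R :=
  if Req_EM_T x 0 then (if Req_EM_T y 0 then 1 else 0) else Rpower x y.

Definition Cexp (z : C) : C :=
  (exp (Re z) * cos (Im z), exp (Re z) * sin (Im z)).

(* The principal logarithm on the half-plane Re w > 0, where Arg w is
   [atan (Im w / Re w)].  It is only applied to 1 - z with |z| < 1. *)
Definition Clog_rhp (w : C) : C := (ln (Cmod w), atan (Im w / Re w)).

Definition Cpower_rhp (w : C) (s : R) : C := Cexp (RtoC s * Clog_rhp w)%C.

(* Functions on the unit disk are represented by total functions [C -> C];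
   every notion below only looks at their values on the disk. *)
Definition disk (z : C) : Prop := Cmod z < 1.

Definition analytic_on_disk (f : C -> C) : Prop :=
  forall z : C, disk z -> ex_derive f z.

Definition class_A0 (f : C -> C) : Prop :=
  analytic_on_disk f /\ f (RtoC 0) = RtoC 0 /\ C_derive f (RtoC 0) = RtoC 1.

(* At z = 0 the quotient z f'(z) / f(z) is taken with its removable value 1,
   which exceeds [gamma] automatically; elsewhere f must not vanish, since
   Coquelicot's division by zero is total. *)
Definition starlike (gamma : R) (f : C -> C) : Prop :=
  class_A0 f /\
  forall z : C, disk z -> z <> RtoC 0 ->
    f z <> RtoC 0 /\ Re (z * C_derive f z / f z)%C > gamma.

Definition has_expansion (f : C -> C) (a : nat -> C) : Prop :=
  forall z : C, disk z -> is_pseries a z (f z).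

(* [is_hadamard f g h]: h = f * g on the disk.  Expansions being unique,
   h is determined on the disk by f and g. *)
Definition is_hadamard (f g h : C -> C) : Prop :=
  exists a b : nat -> C,
    has_expansion f a /\ has_expansion g b /\
    has_expansion h (fun k => (a k * b k)%C).

Definition koebe (gamma : R) (z : C) : C :=
  (z / Cpower_rhp (RtoC 1 - z) (2 - 2 * gamma))%C.

Definition prestarlike (gamma : R) (f : C -> C) : Prop :=
  class_A0 f /\
  exists h : C -> C, is_hadamard (koebe gamma) f h /\ starlike gamma h.

Fixpoint pochhammer (x : R) (k : nat) : R :=
  match k with
  | O => 1
  | S j => pochhammer x j * (x + INR j)
  end.

Definition cesaro_B (b c : R) (k : nat) : R :=
  match k with
  | O => 1
  | S _ => (1 + b - c) / b * (pochhammer b k / pochhammer c k)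
  end.

(* The polynomial s_n^{(b-1,c)}; [sum_n_m] is 0 when n < 2. *)
Definition cesaro_poly (n : nat) (b c : R) (z : C) : C :=
  (z + sum_n_m (fun k => RtoC (cesaro_B b c (n - k) / cesaro_B b c (n - 1))
                         * z ^ k) 2 n)%C.

(* Main.v *)
Require Import Defs.
From Stdlib Require Import Reals Factorial Lra Lia Psatz FunctionalExtensionality.
From Coquelicot Require Import Coquelicot.

Open Scope R_scope.

(** Write [h z = z * Q z], [Q z = sum_k a_k z^k], for the convolution of the
    Koebe-type function with the polynomial.  The coefficient [a_k] is the
    product of a binomial coefficient and of a quotient of two [cesaro_B], and
    [z h'/h - gamma = P/Q] where [P z = sum_k (k + 1 - gamma) a_k z^k].  Both
    polynomials are real, so it is enough to treat the upper half of the disk;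
    and there [Re (P/Q) > 0] follows as soon as [P] and [Q] both map it into the
    first quadrant.

    Such mapping properties are statements about cosine and sine sums with
    nonnegative coefficients.  With [u_k] the coefficients of [P] (or [Q]) times
    [|z|^k], the hypotheses [h1] to [h4] give [u_0 >= u_1 >= W_2 u_2 >=
    W_3 u_3 >= ...] with [W_k = (k + alpha)^lambda (k + beta)^mu].  Taking a power
    of the weights reduces this to [lambda + mu = 1], where
    [W_k >= k] and [W_k / k] is nonincreasing ([normalized_weight_regular],
    [power_weight_transfer]).  The sums are nonnegative for two reasons:
    - away from one end of the interval ([0] for cosines, [PI] for sines)
      [2 u_2 <= u_1] and monotonicity suffice, because after multiplication by
      [2 sin (t/2)] everything reduces to the sequence 2, 1, 1, 1, ...
      ([cos_sum_nonneg_away], [sin_sum_nonneg_away]);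
    - close to [0] the cosine sum starts with enough positive terms
      ([cos_sum_nonneg_near]), and close to [PI] the sine sum is compared with
      [sin y - sin (2y) / 2 + sin (3y) / 3 - ...], whose partial sums
      stay between [0] and [sin y] ([alt_sin_sum_bounds]).
    The two are combined in [real_poly_first_quadrant].

    For [n = 3] the chain of inequalities breaks at [W_2 u_2 <= u_1]: the ratio
    [cesaro_B 0 / cesaro_B 1] is [c / (1 + b - c)], while [h2] speaks of [c / b].
    Then [h4] together with [alpha, beta <= 3/2] gives [7 u_2 <= 5 u_1] for [P], and
    [Re (P/Q) > 0] is verified directly as a quadratic inequality in the cosine
    of the argument ([three_term_quotient]).

    The expansion of the Koebe-type function comes from the differential
    equation [(1 - w) G' = s G] of the binomial series, integrated along the
    segment from [0] to [z] ([binomial_series_disk]). *)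

(** * Summation by parts and trigonometric sums away from the endpoint *)

(** Summation by parts turns the sum into a combination of the partial sums of
    [g] with the nonnegative weights [a k - a (S k)].  The partial sums before
    [J] do not hurt, and the weights from [J] on add up to [a J]. *)
Lemma abel_lower_bound (a g : nat -> R) (J : nat) (M : R) :
  (forall k, 0 <= a k) -> (forall k, a (S k) <= a k) ->
  (forall k, (k < J)%nat -> 0 <= sum_f_R0 g k) ->
  (forall k, - M <= sum_f_R0 g k) -> 0 <= M ->
  forall N, - (a J * M) <= sum_f_R0 (fun k => a k * g k) N.
Proof.
  intros Ha Hdec Hpos Hlow HM N.
  assert (H : ((N < J)%nat -> a N * sum_f_R0 g N <= sum_f_R0 (fun k => a k * g k) N) /\
     ((J <= N)%nat -> a N * sum_f_R0 g N - (a J - a N) * M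
                      <= sum_f_R0 (fun k => a k * g k) N)).
  { induction N as [|N [IH1 IH2]].
    - split; intros H; simpl.
      + lra.
      + replace J with 0%nat by lia. lra.
    - simpl sum_f_R0. split; intros H.
      + specialize (IH1 ltac:(lia)). specialize (Hpos N ltac:(lia)).
        specialize (Hdec N). nra.
      + destruct (Nat.eq_dec J (S N)) as [-> | HJ].
        * specialize (IH1 ltac:(lia)). specialize (Hpos N ltac:(lia)).
          specialize (Hdec N). nra.
        * specialize (IH2 ltac:(lia)). specialize (Hlow N).
          specialize (Hdec N). nra. }
  destruct H as [H1 H2].
  destruct (Nat.lt_ge_cases N J) as [HN | HN].
  - specialize (H1 HN). specialize (Hpos N HN).
    assert (0 <= a N * sum_f_R0 g N) by (apply Rmult_le_pos; auto).
    assert (0 <= a J * M) by (apply Rmult_le_pos; auto). lra.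
  - specialize (H2 HN). specialize (Hlow N). specialize (Ha N). nra.
Qed.

Lemma abel_nonneg (a g : nat -> R) (N : nat) :
  (forall k, 0 <= a k) -> (forall k, a (S k) <= a k) ->
  (forall k, 0 <= sum_f_R0 g k) -> 0 <= sum_f_R0 (fun k => a k * g k) N.
Proof.
  intros Ha Hdec Hpos.
  pose proof (abel_lower_bound a g 0 0 Ha Hdec) as H.
  specialize (H ltac:(intros; lia)).
  specialize (H ltac:(intros k; specialize (Hpos k); lra) ltac:(lra) N). lra.
Qed.

Lemma sin_half_double (t : R) : sin t = 2 * sin (t / 2) * cos (t / 2).
Proof. rewrite <- sin_2a. f_equal. field. Qed.

Lemma cos_half_double (t : R) : cos t = 1 - 2 * sin (t / 2) * sin (t / 2).
Proof. rewrite <- cos_2a_sin. f_equal. field. Qed.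

(** Half the Dirichlet kernel, with the frequency [j + 1] at index [j]; the last
    frequency is thus [m + 1], whence the half-integer [m + 3/2]. *)
Lemma cos_sum_closed (t : R) (m : nat) :
  2 * sin (t / 2) * (1 / 2 + sum_f_R0 (fun j => cos (INR (S j) * t)) m)
  = sin ((INR m + 3 / 2) * t).
Proof.
  induction m as [|m IH].
  - simpl sum_f_R0. simpl INR.
    replace ((0 + 3 / 2) * t) with (t + t / 2) by field.
    rewrite sin_plus. rewrite Rmult_1_l, (sin_half_double t), (cos_half_double t).
    pose proof (sin2_cos2 (t / 2)) as H. unfold Rsqr in H.
    set (s := sin (t / 2)) in *. set (x := cos (t / 2)) in *.
    replace (2 * s * x * x) with (2 * s * (x * x)) by ring.
    replace (x * x) with (1 - s * s) by lra. field.
  - rewrite tech5, <- Rplus_assoc, Rmult_plus_distr_l, IH.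
    rewrite !S_INR.
    replace ((INR m + 3 / 2) * t) with ((INR m + 1 + 1) * t - t / 2) by field.
    replace ((INR m + 1 + 3 / 2) * t) with ((INR m + 1 + 1) * t + t / 2) by field.
    rewrite sin_plus, sin_minus. ring.
Qed.

Lemma sin_sum_closed (t : R) (m : nat) :
  2 * sin (t / 2) * sum_f_R0 (fun j => sin (INR (S j) * t)) m
  = cos (t / 2) - cos ((INR m + 3 / 2) * t).
Proof.
  induction m as [|m IH].
  - simpl sum_f_R0. simpl INR.
    replace ((0 + 3 / 2) * t) with (t + t / 2) by field.
    rewrite cos_plus. rewrite Rmult_1_l, (sin_half_double t), (cos_half_double t). ring.
  - rewrite tech5, Rmult_plus_distr_l, IH.
    rewrite !S_INR.
    replace ((INR m + 3 / 2) * t) with ((INR m + 1 + 1) * t - t / 2) by field.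
    replace ((INR m + 1 + 3 / 2) * t) with ((INR m + 1 + 1) * t + t / 2) by field.
    rewrite cos_plus, cos_minus. ring.
Qed.

Lemma sum_split_first (f : nat -> R) (m : nat) :
  sum_f_R0 f m = f 0%nat + sum_f_R0 (fun j => match j with O => 0 | S _ => f j end) m.
Proof. induction m as [|m IH]; simpl; [ring | rewrite IH; ring]. Qed.

(** Since [2 v 1 <= v 0], the sequence [v] is a nonnegative multiple of the first
    unit vector plus [2 v 1, v 1, v 2, ...]; by summation by parts only the
    sequences 2, 1, ..., 1 have to be checked for the latter. *)
Lemma sum_nonneg_halved_first (v g : nat -> R) (N : nat) :
  (forall k, 0 <= v k) -> 2 * v 1%nat <= v 0%nat ->
  (forall k, v (S (S k)) <= v (S k)) ->
  0 <= g 0%nat ->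
  (forall m, 0 <= g 0%nat + sum_f_R0 g m) ->
  0 <= sum_f_R0 (fun j => v j * g j) N.
Proof.
  intros Hv H2 Hdec Hg0 HG.
  pose proof (abel_nonneg (fun j => match j with O => v 1%nat | S _ => v j end)
    (fun j => match j with O => 2 * g 0%nat | S _ => g j end) N) as H.
  rewrite sum_split_first.
  rewrite sum_split_first in H.
  rewrite (sum_eq _ (fun j => match j with O => 0 | S _ => v j * g j end)) in H
    by (intros [|i] _; reflexivity).
  assert (H0 : 0 <= v 1%nat * (2 * g 0%nat) +
     sum_f_R0 (fun j => match j with O => 0 | S _ => v j * g j end) N).
  { apply H.
    - intros [|k]; apply Hv.
    - intros [|k]; [lra | apply Hdec].
    - intros k. specialize (HG k). rewrite sum_split_first in HG.
      rewrite sum_split_first.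
      rewrite (sum_eq _ (fun j => match j with O => 0 | S _ => g j end))
        by (intros [|i] _; reflexivity).
      lra. }
  nra.
Qed.

(** For the extremal sequences 2, 1, ..., 1 the sum, multiplied by [2 s] with
    [s = sin (t / 2)], is at least [(1 - s) (4 s^2 + 4 s - 1)]. *)
Lemma cos_sum_nonneg_away (v : nat -> R) (N : nat) (t : R) :
  (forall k, 0 <= v k) -> 2 * v 1%nat <= v 0%nat ->
  (forall k, v (S (S k)) <= v (S k)) ->
  0 < sin (t / 2) -> 1 <= 4 * sin (t / 2) ^ 2 + 4 * sin (t / 2) ->
  0 <= v 0%nat + sum_f_R0 (fun j => v j * cos (INR (S j) * t)) N.
Proof.
  intros Hv H2 Hdec Hs Hs4.
  set (s := sin (t / 2)) in *.
  assert (Hs1 : s <= 1) by apply SIN_bound.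
  assert (Hct : cos t = 1 - 2 * s ^ 2).
  { rewrite (cos_half_double t). unfold s. ring. }
  pose (g := fun j => match j with O => 1 + cos t | S _ => cos (INR (S j) * t) end).
  replace (v 0%nat + sum_f_R0 (fun j => v j * cos (INR (S j) * t)) N)
    with (sum_f_R0 (fun j => v j * g j) N).
  - apply sum_nonneg_halved_first; auto.
    + unfold g. pose proof (COS_bound t). lra.
    + intros m.
      assert (Hg : g 0%nat + sum_f_R0 g m
        = 3 / 2 + cos t + (1 / 2 + sum_f_R0 (fun j => cos (INR (S j) * t)) m)).
      { rewrite (sum_split_first g), (sum_split_first (fun j => cos _)).
        unfold g at 1 2. change (INR 1) with 1. rewrite Rmult_1_l.
        rewrite (sum_eq _ (fun j => match j with O => 0 | S _ => cos (INR (S j) * t) end))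
          by (intros [|i] _; reflexivity).
        cbv beta. field. }
      rewrite Hg. clear Hg.
      pose proof (cos_sum_closed t m) as HC. fold s in HC.
      pose proof (SIN_bound ((INR m + 3 / 2) * t)) as HB.
      set (X := 1 / 2 + _) in *. rewrite <- HC in HB. rewrite Hct.
      assert (Hf : 0 <= (1 - s) * (4 * s ^ 2 + 4 * s - 1)) by (apply Rmult_le_pos; lra).
      assert (0 <= 2 * s * (3 / 2 + (1 - 2 * s ^ 2) + X)) by nra.
      apply Rmult_le_reg_l with (2 * s); lra.
  - rewrite sum_split_first, (sum_split_first (fun j => v j * cos _)).
    unfold g at 1. change (INR 1) with 1. rewrite Rmult_1_l.
    rewrite (sum_eq _ (fun j => match j with O => 0 | S _ => v j * cos (INR (S j) * t) end))
      by (intros [|i] _; reflexivity).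
    ring.
Qed.

(** The mirror image of [cos_sum_nonneg_away]: with [x = cos (t / 2)] the extremal
    sums times [2 sin (t / 2)] are at least [(1 - x) (4 x^2 + 4 x - 1)]. *)
Lemma sin_sum_nonneg_away (v : nat -> R) (N : nat) (t : R) :
  (forall k, 0 <= v k) -> 2 * v 1%nat <= v 0%nat ->
  (forall k, v (S (S k)) <= v (S k)) ->
  0 < sin (t / 2) -> 0 <= cos (t / 2) ->
  1 <= 4 * cos (t / 2) ^ 2 + 4 * cos (t / 2) ->
  0 <= sum_f_R0 (fun j => v j * sin (INR (S j) * t)) N.
Proof.
  intros Hv H2 Hdec Hs Hc Hs4.
  pose proof (sin_half_double t) as Hst.
  pose proof (sin2_cos2 (t/2)) as Hsc. unfold Rsqr in Hsc.
  set (s := sin (t / 2)) in *. set (x := cos (t / 2)) in *.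
  assert (Hx1 : x <= 1) by apply COS_bound.
  apply (sum_nonneg_halved_first v (fun j => sin (INR (S j) * t))); auto.
  - change (INR 1) with 1. rewrite Rmult_1_l, Hst. nra.
  - intros m. change (INR 1) with 1. rewrite Rmult_1_l.
    pose proof (sin_sum_closed t m) as HC. fold s x in HC.
    pose proof (COS_bound ((INR m + 3 / 2) * t)) as HB.
    set (X := sum_f_R0 _ _) in *. rewrite Hst.
    assert (Hf : 0 <= (1 - x) * (4 * x ^ 2 + 4 * x - 1)) by (apply Rmult_le_pos; lra).
    assert (0 <= 2 * s * (2 * s * x + X)).
    { replace (2 * s * (2 * s * x + X)) with (4 * (s * s) * x + 2 * s * X) by ring.
      rewrite HC. replace (s * s) with (1 - x * x) by lra. nra. }
    apply Rmult_le_reg_l with (2 * s); lra.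
Qed.

(** * Trigonometric sums near the endpoint *)

Lemma sin_lower_cubic (x : R) : 0 <= x <= 1 -> x - x ^ 3 / 6 <= sin x.
Proof.
  intros Hx. pose proof PI2_3_2 as Hpi.
  destruct (SIN x) as [H _]; try lra.
  apply Rle_trans with (2 := H).
  unfold sin_lb, sin_approx, sin_term. simpl sum_f_R0.
  simpl pow. simpl INR.
  assert (0 <= x * x <= 1) by nra.
  assert (0 <= x * (x * x) * (x * x)) by (repeat apply Rmult_le_pos; lra).
  set (p := x * (x * x) * (x * x)) in *.
  assert (p * (x * x) <= p) by nra.
  assert (0 <= p * (x * x)) by (apply Rmult_le_pos; lra).
  match goal with |- _ <= ?R => replace R with (x - x ^ 3 / 6 + p / 120 - p * (x * x) / 5040) by (unfold p; field) end.
  lra.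
Qed.

Lemma cos_lower_quadratic (x : R) : 0 <= x -> 1 - x ^ 2 / 2 <= cos x.
Proof.
  intros Hx. rewrite (cos_half_double x).
  destruct (Req_dec x 0) as [-> | Hx0].
  - replace (0 / 2) with 0 by field. rewrite sin_0. lra.
  - pose proof (sin_lt_x (x / 2) ltac:(lra)) as H1.
    pose proof (SIN_bound (x / 2)).
    assert (- (x / 2) < sin (x / 2)).
    { destruct (Rle_lt_dec x 2) as [H2 | H2]; [| lra].
      pose proof (sin_lower_cubic (x / 2) ltac:(lra)). nra. }
    nra.
Qed.

(** The partial sums of [1/2 + sum_k cos (k t)] are positive until [(k + 1/2) t]
    exceeds [PI]; from there on [v] is at most [v 0 * t / PI], up to lower-order
    terms, and the oscillation of the kernel, at most [1 / (2 sin (t / 2))], costs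
    at most the half of [v 0] that is kept in reserve. *)
Lemma cos_sum_nonneg_near (v : nat -> R) (N : nat) (t : R) :
  (forall k, 0 <= v k) -> (forall k, v (S k) <= v k) ->
  (forall k, (INR k + 1) * v k <= v 0%nat) ->
  0 < t <= 21 / 50 ->
  0 <= v 0%nat + sum_f_R0 (fun j => v j * cos (INR (S j) * t)) N.
Proof.
  intros Hv Hdec Hharm Ht.
  pose proof PI2_3_2 as Hpi.
  assert (Hs : t / 2 - (t / 2) ^ 3 / 6 <= sin (t / 2)) by (apply sin_lower_cubic; lra).
  assert (Hs0 : 0 < sin (t / 2)) by (apply sin_gt_0; lra).
  set (s := sin (t / 2)) in *.
  assert (Hpt : 3 <= PI / t) by (apply Rle_div_r; lra).
  (* J is the first index at which (J + 3/2) t exceeds PI. *)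
  destruct (nfloor_ex (PI / t - 1 / 2)) as [J [HJ1 HJ2]]; [lra |].
  pose (g := fun j => match j with O => 1 / 2 + cos t | S _ => cos (INR (S j) * t) end).
  assert (Hg : forall m, sum_f_R0 g m = sin ((INR m + 3 / 2) * t) / (2 * s)).
  { intros m. rewrite <- cos_sum_closed. fold s.
    rewrite (sum_split_first g), (sum_split_first (fun j => cos _)).
    unfold g at 1. change (INR 1) with 1. rewrite Rmult_1_l.
    rewrite (sum_eq _ (fun j => match j with O => 0 | S _ => cos (INR (S j) * t) end))
      by (intros [|i] _; reflexivity).
    cbv beta. field. lra. }
  assert (HM : - (v J * (1 / (2 * s))) <= sum_f_R0 (fun j => v j * g j) N).
  { apply abel_lower_bound; auto.
    - intros k Hk. rewrite Hg. apply Rdiv_le_0_compat; [| lra].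
      apply sin_ge_0.
      + apply Rmult_le_pos; [pose proof (pos_INR k) |]; lra.
      + apply lt_INR in Hk.
        assert (Hk1 : INR k + 1 <= INR J) by (rewrite <- S_INR; apply le_INR; apply INR_lt in Hk; lia).
        assert (H : INR k + 3 / 2 <= PI / t) by lra.
        apply Rle_div_r in H; lra.
    - intros k. rewrite Hg. pose proof (SIN_bound ((INR k + 3 / 2) * t)).
      assert (0 < / (2 * s)) by (apply Rinv_0_lt_compat; lra).
      unfold Rdiv. nra.
    - apply Rdiv_le_0_compat; lra. }
  (* This is (J + 1) sin (t/2) >= 1; the product is close to PI/2. *)
  assert (HJ : v J <= s * v 0%nat).
  { assert (H1 : 1 <= (INR J + 1) * s).
    { assert (Hpos : 0 <= t / 2 - (t / 2) ^ 3 / 6) by nra.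
      apply Rle_trans with ((PI / t - 1 / 2) * (t / 2 - (t / 2) ^ 3 / 6)).
      - replace ((PI / t - 1 / 2) * (t / 2 - (t / 2) ^ 3 / 6))
          with ((PI - t / 2) * (1 / 2 - t * t / 48)) by (field; lra).
        assert (t * t <= 1) by nra. nra.
      - apply Rmult_le_compat; lra. }
    specialize (Hharm J). specialize (Hv J). nra. }
  assert (HJ' : v J * (1 / (2 * s)) <= v 0%nat / 2).
  { replace (v J * (1 / (2 * s))) with (v J / (2 * s)) by (field; lra).
    apply Rle_div_l; lra. }
  replace (v 0%nat + sum_f_R0 (fun j => v j * cos (INR (S j) * t)) N)
    with (v 0%nat / 2 + sum_f_R0 (fun j => v j * g j) N); [lra |].
  rewrite (sum_split_first (fun j => v j * g j)), (sum_split_first (fun j => v j * cos _)).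
  unfold g at 1. change (INR 1) with 1. rewrite Rmult_1_l.
  rewrite (sum_eq _ (fun j => match j with O => 0 | S _ => v j * cos (INR (S j) * t) end))
    by (intros [|i] _; reflexivity).
  field.
Qed.

(** A form of [x cos x <= sin x] that goes by induction on [k], from the addition
    formulas alone. *)
Lemma mul_sin_cos_le_sin_mul (y : R) (k : nat) :
  0 <= y -> INR k * y <= PI / 2 ->
  INR k * sin y * cos (INR k * y) <= sin (INR k * y).
Proof.
  intros Hy. induction k as [|k IH]; intros Hk.
  - simpl INR. rewrite !Rmult_0_l, sin_0. lra.
  - rewrite S_INR in *. pose proof (pos_INR k) as HkR.
    assert (Hky : 0 <= INR k * y) by (apply Rmult_le_pos; lra).
    specialize (IH ltac:(nra)).
    replace ((INR k + 1) * y) with (INR k * y + y) in * by ring.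
    rewrite sin_plus, cos_plus.
    assert (0 <= cos (INR k * y)) by (apply cos_ge_0; lra).
    assert (0 <= sin (INR k * y)) by (apply sin_ge_0; lra).
    assert (0 <= cos y) by (apply cos_ge_0; lra).
    assert (0 <= sin y) by (apply sin_ge_0; lra).
    assert (INR k * sin y * cos (INR k * y) * cos y <= sin (INR k * y) * cos y)
      by (apply Rmult_le_compat_r; lra).
    assert (cos y <= 1) by apply COS_bound.
    assert (0 <= cos (INR k * y) * sin y) by (apply Rmult_le_pos; lra).
    assert (cos (INR k * y) * sin y * cos y <= cos (INR k * y) * sin y) by nra.
    assert (0 <= (INR k + 1) * sin y * (sin (INR k * y) * sin y))
      by (repeat apply Rmult_le_pos; lra).
    nra.
Qed.

(** The function [sin x / x] is decreasing on the first quarter period; only its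
    values at consecutive multiples of [y] are compared. *)
Lemma sinc_decreasing (y : R) (k : nat) :
  0 <= y -> INR (S (S k)) * y <= PI / 2 ->
  sin (INR (S (S k)) * y) / INR (S (S k)) <= sin (INR (S k) * y) / INR (S k).
Proof.
  intros Hy Hk.
  assert (HS : 0 < INR (S k)) by (apply lt_0_INR; lia).
  rewrite (S_INR (S k)) in *.
  set (m := INR (S k)) in *.
  assert (Hmy : 0 <= m * y) by (apply Rmult_le_pos; lra).
  pose proof (mul_sin_cos_le_sin_mul y (S k) Hy ltac:(fold m; nra)) as H.
  fold m in H.
  apply Rle_div_l; [lra |].
  replace (sin (m * y) / m * (m + 1)) with ((sin (m * y) * (m + 1)) / m) by (field; lra).
  apply Rle_div_r; [lra |].
  replace ((m + 1) * y) with (m * y + y) in * by ring.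
  rewrite sin_plus.
  assert (0 <= sin (m * y)) by (apply sin_ge_0; lra).
  assert (cos y <= 1) by apply COS_bound.
  assert (m * (sin (m * y) * cos y) <= m * sin (m * y)).
  { apply Rmult_le_compat_l; nra. }
  nra.
Qed.

(** The Fejer-Jackson sum [sum_k sin (k t) / k] at [t = PI - y]. *)
Definition alt_sin_sum (m : nat) (y : R) : R :=
  sum_f_R0 (fun j => (-1) ^ j * (sin (INR (S j) * y) / INR (S j))) m.

Lemma alternating_sum_bounds (f : nat -> R) (m : nat) :
  (forall j, (j <= m)%nat -> 0 <= f j) ->
  (forall j, (S j <= m)%nat -> f (S j) <= f j) ->
  0 <= sum_f_R0 (fun j => (-1) ^ j * f j) m <= f 0%nat.
Proof.
  intros Hpos Hdec.
  set (F := sum_f_R0 (fun j => (-1) ^ j * f j)).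
  assert (H : ((-1) ^ m = 1 /\ f m <= F m <= f 0%nat) \/
              ((-1) ^ m = -1 /\ 0 <= F m <= f 0%nat - f m)).
  { induction m as [|m IH].
    - left. unfold F. simpl. lra.
    - pose proof (Hdec m ltac:(lia)). pose proof (Hpos (S m) ltac:(lia)).
      assert (HF : F (S m) = F m + (-1) * (-1) ^ m * f (S m)) by reflexivity.
      destruct IH as [[He Hb] | [He Hb]]; auto.
      + right. rewrite HF, He. simpl pow. rewrite He. lra.
      + left. rewrite HF, He. simpl pow. rewrite He. lra. }
  pose proof (Hpos m ltac:(lia)). lra.
Qed.

Lemma alt_cos_sum_closed (y : R) (m : nat) :
  2 * cos (y / 2) * sum_f_R0 (fun j => (-1) ^ j * cos (INR (S j) * y)) m
  = cos (y / 2) + (-1) ^ m * cos ((INR m + 3 / 2) * y).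
Proof.
  induction m as [|m IH].
  - simpl sum_f_R0. simpl INR. simpl pow.
    replace ((0 + 3 / 2) * y) with (y + y / 2) by field.
    rewrite cos_plus, !Rmult_1_l, (sin_half_double y), (cos_half_double y).
    pose proof (sin2_cos2 (y / 2)) as H. unfold Rsqr in H.
    set (s := sin (y / 2)) in *. set (x := cos (y / 2)) in *.
    ring.
  - rewrite tech5, Rmult_plus_distr_l, IH.
    rewrite !S_INR.
    replace ((INR m + 3 / 2) * y) with ((INR m + 1 + 1) * y - y / 2) by field.
    replace ((INR m + 1 + 3 / 2) * y) with ((INR m + 1 + 1) * y + y / 2) by field.
    rewrite cos_plus, cos_minus. simpl pow. ring.
Qed.

Lemma is_derive_alt_sin_sum (m : nat) (y : R) :
  is_derive (alt_sin_sum m) y (sum_f_R0 (fun j => (-1) ^ j * cos (INR (S j) * y)) m).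
Proof.
  induction m as [|m IH].
  - unfold alt_sin_sum; simpl. auto_derive; [trivial | field].
  - apply (is_derive_ext
      (fun y => alt_sin_sum m y + (-1) ^ S m * (sin (INR (S (S m)) * y) / INR (S (S m))))).
    { intros x. reflexivity. }
    rewrite tech5. apply (is_derive_plus (alt_sin_sum m)); [exact IH |].
    assert (INR (S (S m)) <> 0) by (apply not_0_INR; lia).
    set (c := INR (S (S m))) in *. set (e := (-1) ^ S m).
    auto_derive; [trivial | field; auto].
Qed.

(** As long as [(m + 1) y <= 3/2] the terms decrease and the sum alternates.
    Beyond that the sum is close to its limit [y / 2]: its derivative is
    [1/2 + (-1)^m cos (M u) / (2 cos (u / 2))] with [M = m + 3/2], and an
    integration by parts bounds the integral of the oscillating part by about
    [1 / (2 M)], which is less than [0.42 y]. *)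
Lemma alt_sin_sum_bounds (m : nat) (y : R) :
  0 < y <= 21 / 50 -> 0 <= alt_sin_sum m y <= sin y.
Proof.
  intros Hy. pose proof PI2_3_2 as Hpi.
  assert (Hsy : y - y ^ 3 / 6 <= sin y) by (apply sin_lower_cubic; lra).
  pose proof (pos_INR m) as Hm.
  destruct (Rle_lt_dec ((INR m + 1) * y) (3 / 2)) as [Hs | Hl].
  - replace (sin y) with (sin (INR 1 * y) / INR 1)
      by (change (INR 1) with 1; rewrite Rmult_1_l; field).
    apply (alternating_sum_bounds (fun j => sin (INR (S j) * y) / INR (S j))).
    + intros j Hj. apply le_INR in Hj. rewrite S_INR. pose proof (pos_INR j).
      apply Rdiv_le_0_compat; [| lra]. apply sin_ge_0; nra.
    + intros j Hj. apply sinc_decreasing; [lra |].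
      apply le_INR in Hj. rewrite S_INR. nra.
  - set (e := (-1) ^ m).
    assert (He : Rabs e = 1) by (unfold e; rewrite <- RPow_abs, (Rabs_left (-1)) by lra; replace (- -1) with 1 by ring; apply pow1).
    set (M := INR m + 3 / 2) in *.
    assert (Hcos : forall u, 0 <= u <= y -> 39 / 40 <= cos (u / 2)).
    { intros u Hu. pose proof (cos_lower_quadratic (u / 2) ltac:(lra)). nra. }
    (* The integration by parts: what is left after removing the boundary term
       has a derivative of order y / M, to which the mean value theorem applies. *)
    destruct (MVT_gen (fun u => alt_sin_sum m u - u / 2 - e * sin (M * u) / (2 * M * cos (u / 2)))
      0 y (fun u => - (e * sin (M * u)) * (sin (u / 2) / (4 * M * (cos (u / 2)) ^ 2))))
      as [u [Hu HK]].
    + rewrite Rmin_left, Rmax_right by lra. intros u Hu.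
      specialize (Hcos u ltac:(lra)).
      assert (HD : 2 * cos (u / 2) * sum_f_R0 (fun j => (-1) ^ j * cos (INR (S j) * u)) m
        = cos (u / 2) + e * cos (M * u)) by apply alt_cos_sum_closed.
      assert (HDm := is_derive_alt_sin_sum m u).
      set (D := sum_f_R0 _ _) in *.
      replace (- (e * sin (M * u)) * (sin (u / 2) / (4 * M * cos (u / 2) ^ 2)))
        with (D - (1 / 2 + (e * cos (M * u) / (2 * cos (u / 2))
              + e * sin (M * u) * sin (u / 2) / (4 * M * cos (u / 2) ^ 2)))).
      2:{ replace D with ((cos (u / 2) + e * cos (M * u)) / (2 * cos (u / 2))).
          - field. unfold M. lra.
          - rewrite <- HD. field. lra. }
      apply (is_derive_ext (fun u => alt_sin_sum m u - (u / 2 + e * sin (M * u) / (2 * M * cos (u / 2))))).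
      { intros w. change (alt_sin_sum m w - (w / 2 + e * sin (M * w) / (2 * M * cos (w / 2)))
          = alt_sin_sum m w - w / 2 - e * sin (M * w) / (2 * M * cos (w / 2))). ring. }
      apply (is_derive_minus (alt_sin_sum m)); [exact HDm |].
      assert (M <> 0) by (unfold M; lra).
      auto_derive.
      * apply Rmult_integral_contrapositive_currified; lra.
      * replace (u * / 2) with (u / 2) by reflexivity. field. split; lra.
    + rewrite Rmin_left, Rmax_right by lra. intros u Hu.
      specialize (Hcos u ltac:(lra)).
      assert (M <> 0) by (unfold M; lra).
      apply continuity_pt_filterlim.
      apply (ex_derive_continuous (fun u => alt_sin_sum m u - u / 2 - e * sin (M * u) / (2 * M * cos (u / 2)))).
      apply (ex_derive_minus (fun u => alt_sin_sum m u - u / 2)).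
      * apply (ex_derive_minus (alt_sin_sum m)).
        -- eexists; apply is_derive_alt_sin_sum.
        -- auto_derive; trivial.
      * auto_derive. apply Rmult_integral_contrapositive_currified; [lra |].
        replace (u * / 2) with (u / 2) by reflexivity. lra.
    + rewrite Rmin_left, Rmax_right in Hu by lra.
      assert (H0 : alt_sin_sum m 0 = 0).
      { unfold alt_sin_sum. apply sum_eq_R0. intros i _. rewrite Rmult_0_r, sin_0. unfold Rdiv. ring. }
      rewrite H0, Rmult_0_r, sin_0 in HK.
      pose proof (Hcos y ltac:(lra)) as Hcy. pose proof (Hcos u ltac:(lra)) as Hcu.
      set (A := e * sin (M * y)) in *.
      assert (HM1 : 3 / 2 <= M * y) by (unfold M; nra).
      assert (HMpos : 0 < M) by (unfold M; lra).
      assert (Hsb : forall w, Rabs (e * sin w) <= 1).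
      { intros w. rewrite Rabs_mult, He, Rmult_1_l. apply Rabs_le. apply SIN_bound. }
      assert (HA : Rabs (A / (2 * M * cos (y / 2))) <= 0.36 * y).
      { unfold Rdiv. rewrite Rabs_mult. unfold A.
        assert (HD0 : 0 < 2 * M * cos (y / 2)) by nra.
        rewrite (Rabs_pos_eq (/ _)) by (apply Rlt_le, Rinv_0_lt_compat; exact HD0).
        apply Rle_trans with (1 * / (2 * M * cos (y / 2))).
        - apply Rmult_le_compat_r; [apply Rlt_le, Rinv_0_lt_compat; exact HD0 | apply Hsb].
        - apply Rle_div_l; [exact HD0 |]. nra. }
      assert (HB : Rabs (- (e * sin (M * u)) * (sin (u / 2) / (4 * M * cos (u / 2) ^ 2)) * (y - 0)) <= 0.06 * y).
      { rewrite Rminus_0_r, Rabs_mult, (Rabs_pos_eq y) by lra.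
        apply Rmult_le_compat_r; [lra |].
        rewrite Rabs_mult, Rabs_Ropp.
        assert (Hsu : 0 <= sin (u / 2) <= 21 / 100).
        { split; [apply sin_ge_0; lra |].
          destruct (Req_dec u 0) as [-> |]; [replace (0 / 2) with 0 by field; rewrite sin_0; lra |].
          pose proof (sin_lt_x (u / 2) ltac:(lra)). lra. }
        assert (HD0 : 4 <= 4 * M * cos (u / 2) ^ 2).
        { assert (3 <= M) by (apply Rmult_le_reg_r with y; lra).
          assert (1/3 <= cos (u/2) ^ 2) by nra. nra. }
        assert (HQ : 0 <= sin (u / 2) / (4 * M * cos (u / 2) ^ 2) <= 0.06).
        { split; [apply Rdiv_le_0_compat; lra |]. apply Rle_div_l; lra. }
        rewrite (Rabs_pos_eq (sin (u / 2) / _)) by lra.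
        pose proof (Hsb (M * u)). pose proof (Rabs_pos (e * sin (M * u))). nra. }
      assert (HF : Rabs (alt_sin_sum m y - y / 2) <= 0.42 * y).
      { replace (alt_sin_sum m y - y / 2) with
          (A / (2 * M * cos (y / 2)) + - (e * sin (M * u)) * (sin (u / 2) / (4 * M * cos (u / 2) ^ 2)) * (y - 0)).
        - eapply Rle_trans; [apply Rabs_triang |]. lra.
        - rewrite <- HK. unfold Rdiv. ring. }
      apply Rabs_le_between in HF.
      assert (y ^ 3 <= 0.2 * y) by (assert (y * y <= 0.2) by nra; nra).
      lra.
Qed.

(** * Real polynomials on the upper half-disk *)

(** The properties of the weights that the sine sum near [PI] relies on.  Index
    [j] belongs to the frequency [j + 1], so the last clause says that
    [V j / (j + 1)] is nonincreasing; it fails between 0 and 1, where the weight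
    jumps from 1 to at least 2. *)
Definition regular_weight (V : nat -> R) : Prop :=
  V 0%nat = 1 /\
  (forall j, INR j + 1 <= V j) /\
  (forall j, V j <= V (S j)) /\
  (forall j, (1 <= j)%nat -> V (S j) * (INR j + 1) <= V j * (INR j + 2)).

Definition weight_decreasing (V v : nat -> R) : Prop :=
  (forall j, 0 <= v j) /\ (forall j, V (S j) * v (S j) <= V j * v j).

(** By summation by parts the sum is at least
    [sin y + a N * (alt_sin_sum N y - sin y)], a convex combination of [sin y] and
    [alt_sin_sum N y]. *)
Lemma alt_sum_increasing_multiplier (a : nat -> R) (N : nat) (y : R) :
  0 < y <= 21 / 50 -> a 0%nat = 1 -> (forall j, a j <= 1) ->
  (forall j, (1 <= j)%nat -> a j <= a (S j)) ->
  0 <= sum_f_R0 (fun j => a j * ((-1) ^ j * (sin (INR (S j) * y) / INR (S j)))) N.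
Proof.
  intros Hy Ha0 Ha1 Hinc.
  assert (H : a N * (alt_sin_sum N y - sin y) + sin y
    <= sum_f_R0 (fun j => a j * ((-1) ^ j * (sin (INR (S j) * y) / INR (S j)))) N).
  { induction N as [|N IH].
    - unfold alt_sin_sum. simpl. rewrite Ha0. lra.
    - rewrite tech5.
      assert (HF : alt_sin_sum (S N) y = alt_sin_sum N y
         + (-1) ^ S N * (sin (INR (S (S N)) * y) / INR (S (S N)))) by reflexivity.
      set (f := (-1) ^ S N * _) in *. rewrite HF.
      assert (Hstep : a (S N) * (alt_sin_sum N y - sin y) <= a N * (alt_sin_sum N y - sin y)).
      { destruct N as [|N].
        - replace (alt_sin_sum 0 y) with (sin y); [lra |].
          unfold alt_sin_sum; simpl. rewrite (Rmult_1_l y). field.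
        - pose proof (alt_sin_sum_bounds (S N) y Hy). specialize (Hinc (S N) ltac:(lia)). nra. }
      lra. }
  pose proof (alt_sin_sum_bounds N y Hy). specialize (Ha1 N). nra.
Qed.

Lemma weighted_decreasing (V v : nat -> R) :
  regular_weight V -> weight_decreasing V v -> forall j, v (S j) <= v j.
Proof.
  intros HV Hv j.
  destruct HV as (H0 & H1 & H2 & H3), Hv as (Hp & Hd).
  specialize (H1 (S j)). specialize (H2 j). specialize (Hd j).
  pose proof (Hp j). pose proof (pos_INR (S j)). nra.
Qed.

Lemma weighted_le_head (V v : nat -> R) :
  regular_weight V -> weight_decreasing V v -> forall j, V j * v j <= v 0%nat.
Proof.
  intros HV Hv j.
  destruct HV as (H0 & _), Hv as (_ & Hd).
  induction j as [|j IH]; [rewrite H0; lra | specialize (Hd j); lra].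
Qed.

Lemma weighted_harmonic (V v : nat -> R) :
  regular_weight V -> weight_decreasing V v ->
  forall j, (INR j + 1) * v j <= v 0%nat.
Proof.
  intros HV Hv j.
  apply Rle_trans with (2 := weighted_le_head V v HV Hv j).
  destruct HV as (H0 & H1 & _), Hv as (Hp & _).
  apply Rmult_le_compat_r; auto.
Qed.

Lemma weighted_half (V v : nat -> R) :
  regular_weight V -> weight_decreasing V v -> 2 * v 1%nat <= v 0%nat.
Proof.
  intros HV Hv. pose proof (weighted_harmonic V v HV Hv 1) as H. simpl in H. lra.
Qed.

Lemma sin_plus_nat_PI (w : R) (k : nat) : sin (w + INR k * PI) = (-1) ^ k * sin w.
Proof.
  induction k as [|k IH].
  - simpl. rewrite Rmult_0_l, Rplus_0_r. ring.
  - rewrite S_INR, Rmult_plus_distr_r, Rmult_1_l, <- Rplus_assoc, neg_sin, IH.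
    simpl. ring.
Qed.

(** After the substitution [y = PI - t] and one summation by parts against the
    nonincreasing sequence [V j * v j], what remains are alternating sums with
    coefficients [1 / V j], that is [(j + 1) / V j] times those of [alt_sin_sum]. *)
Lemma sin_sum_nonneg_near (V v : nat -> R) (N : nat) (y : R) :
  regular_weight V -> weight_decreasing V v -> 0 < y <= 21 / 50 ->
  0 <= sum_f_R0 (fun j => v j * sin (INR (S j) * (PI - y))) N.
Proof.
  intros HV Hv Hy. destruct HV as (H0 & H1 & H2 & H3), Hv as (Hp & Hd).
  assert (HVpos : forall j, 0 < V j) by (intros j; specialize (H1 j); pose proof (pos_INR j); lra).
  rewrite (sum_eq _ (fun j => (V j * v j) *
     ((INR j + 1) / V j * ((-1) ^ j * (sin (INR (S j) * y) / INR (S j)))))).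
  - apply abel_nonneg.
    + intros k. apply Rmult_le_pos; [apply Rlt_le |]; auto.
    + exact Hd.
    + intros k. apply (alt_sum_increasing_multiplier (fun j => (INR j + 1) / V j)); auto.
      * rewrite H0. simpl. field.
      * intros j. apply Rle_div_l; [apply HVpos | rewrite Rmult_1_l; auto].
      * intros j Hj. apply Rle_div_l; [apply HVpos |].
        replace ((INR (S j) + 1) / V (S j) * V j) with (((INR (S j) + 1) * V j) / V (S j))
          by (field; apply Rgt_not_eq; apply HVpos).
        apply Rle_div_r; [apply HVpos |]. rewrite S_INR. specialize (H3 j Hj). lra.
  - intros j _.
    assert (Hsin : sin (INR (S j) * (PI - y)) = (-1) ^ j * sin (INR (S j) * y)).
    { replace (INR (S j) * (PI - y)) with (- (INR (S j) * y) + INR (S j) * PI) by ring.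
      rewrite sin_plus_nat_PI, sin_neg. simpl pow. ring. }
    rewrite Hsin, S_INR. field.
    pose proof (pos_INR j). specialize (HVpos j). lra.
Qed.

(** The two regimes overlap: the condition asks for [sin x] above
    [(sqrt 2 - 1) / 2 = 0.2071...], and [sin 0.21] exceeds it. *)
Lemma half_angle_threshold (x : R) :
  21 / 100 <= x <= PI / 2 -> 1 <= 4 * sin x ^ 2 + 4 * sin x.
Proof.
  intros Hx. pose proof PI2_3_2.
  assert (0.2084 <= sin x).
  { apply Rle_trans with (sin (21 / 100)).
    - apply Rle_trans with (2 := sin_lower_cubic (21 / 100) ltac:(lra)). lra.
    - apply sin_incr_1; lra. }
  nra.
Qed.

Lemma weighted_cos_sum_nonneg (V v : nat -> R) (N : nat) (t : R) :
  regular_weight V -> weight_decreasing V v -> 0 <= t <= PI -> 0 <= v 0%nat + sum_f_R0 (fun j => v j * cos (INR (S j) * t)) N.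
Proof.
  intros HV Hv Ht. pose proof (proj1 Hv) as Hp. pose proof PI2_3_2 as Hpi.
  destruct (Req_dec t 0) as [-> | Ht0].
  - apply Rplus_le_le_0_compat; [auto |]. apply cond_pos_sum. intros k.
    rewrite Rmult_0_r, cos_0, Rmult_1_r. auto.
  - destruct (Rle_lt_dec t (21 / 50)) as [Hs | Hl].
    + apply cos_sum_nonneg_near; eauto using weighted_decreasing, weighted_harmonic. lra.
    + apply cos_sum_nonneg_away; eauto using weighted_decreasing, weighted_half.
      * apply sin_gt_0; lra.
      * apply half_angle_threshold; lra.
Qed.

Lemma weighted_sin_sum_nonneg (V v : nat -> R) (N : nat) (t : R) :
  regular_weight V -> weight_decreasing V v -> 0 <= t <= PI -> 0 <= sum_f_R0 (fun j => v j * sin (INR (S j) * t)) N.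
Proof.
  intros HV Hv Ht. pose proof (proj1 Hv) as Hp. pose proof PI2_3_2 as Hpi.
  destruct (Req_dec t PI) as [-> | Htpi].
  - right. symmetry. apply sum_eq_R0. intros j _.
    rewrite sin_eq_0_1; [ring |]. exists (Z.of_nat (S j)). rewrite <- INR_IZR_INZ. reflexivity.
  - destruct (Req_dec t 0) as [-> | Ht0].
    + right. symmetry. apply sum_eq_R0. intros j _. rewrite Rmult_0_r, sin_0. ring.
    + destruct (Rle_lt_dec (PI - t) (21 / 50)) as [Hs | Hl].
      * replace t with (PI - (PI - t)) by ring. apply (sin_sum_nonneg_near V); auto. lra.
      * assert (Hc : cos (t / 2) = sin (PI / 2 - t / 2)) by (symmetry; apply sin_shift).
        apply sin_sum_nonneg_away; eauto using weighted_decreasing, weighted_half.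
        -- apply sin_gt_0; lra.
        -- apply cos_ge_0; lra.
        -- rewrite Hc. apply half_angle_threshold; lra.
Qed.

Lemma RtoC_mult_components (a : R) (w : C) : (RtoC a * w)%C = (a * Re w, a * Im w).
Proof. unfold Cmult, RtoC; simpl. f_equal; unfold Re, Im; ring. Qed.

(** The polynomial [sum_(k <= N) u k z^k], given by its real and imaginary parts so
    that bounds for real sums apply to it directly. *)
Definition real_poly (u : nat -> R) (N : nat) (z : C) : C :=
  (sum_f_R0 (fun k => u k * Re (z ^ k)%C) N, sum_f_R0 (fun k => u k * Im (z ^ k)%C) N).

Lemma polar_pow (r t : R) (k : nat) :
  Cpow (r * cos t, r * sin t) k = (r ^ k * cos (INR k * t), r ^ k * sin (INR k * t)).
Proof.
  induction k as [|k IH].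
  - simpl. rewrite Rmult_0_l, cos_0, sin_0. unfold RtoC. f_equal; ring.
  - rewrite S_INR.
    cbn [Cpow]. rewrite IH. unfold Cmult; simpl.
    replace ((INR k + 1) * t) with (INR k * t + t) by ring.
    rewrite cos_plus, sin_plus. f_equal; ring.
Qed.

Lemma polar_upper (z : C) : 0 <= Im z ->
  exists t, 0 <= t <= PI /\ z = (Cmod z * cos t, Cmod z * sin t).
Proof.
  intros Hz. destruct z as [x y]. unfold Im in Hz; simpl in Hz.
  destruct (Req_dec (Cmod (x, y)) 0) as [H0 | H0].
  - exists 0. split; [pose proof PI_RGT_0; lra |].
    rewrite H0, (Cmod_eq_0 _ H0). unfold RtoC. f_equal; ring.
  - pose proof (Cmod_ge_0 (x, y)) as Hpos.
    assert (Hsq : Cmod (x, y) ^ 2 = x ^ 2 + y ^ 2) by apply Cmod2_alt.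
    set (r := Cmod (x, y)) in *.
    assert (Hx : -1 <= x / r <= 1).
    { split; [apply Rle_div_r | apply Rle_div_l]; nra. }
    exists (acos (x / r)). split; [apply acos_bound |].
    rewrite cos_acos, sin_acos by auto.
    assert (Hs : sqrt (1 - (x / r)²) = y / r).
    { rewrite <- (sqrt_Rsqr (y / r)).
      - f_equal. unfold Rsqr. field_simplify_eq; [lra | auto].
      - apply Rdiv_le_0_compat; lra. }
    rewrite Hs. f_equal; field; auto.
Qed.

(** In polar coordinates the real and imaginary parts are a cosine and a sine sum
    with coefficients [u k * r^k].  The factor [r^k] preserves the weighted
    monotonicity, and [r < 1] makes the inequality for the real part strict. *)
Lemma real_poly_first_quadrant (V u : nat -> R) (N : nat) (z : C) :
  regular_weight V -> weight_decreasing V (fun j => u (S j)) ->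
  0 < u 0%nat -> u 1%nat <= u 0%nat -> disk z -> 0 <= Im z ->
  0 < Re (real_poly u N z) /\ 0 <= Im (real_poly u N z).
Proof.
  intros HV Hu H0 H1 Hz Him.
  destruct (polar_upper z Him) as [t [Ht Hzt]].
  unfold disk in Hz. pose proof (Cmod_ge_0 z) as Hr. set (r := Cmod z) in *.
  destruct N as [|N].
  { unfold real_poly, Re, Im; simpl. lra. }
  assert (Hw : weight_decreasing V (fun j => u (S j) * r ^ S j)).
  { destruct Hu as [Hp Hd], HV as (HV0 & HV1 & _). split.
    - intros j. apply Rmult_le_pos; auto using pow_le.
    - intros j. cbv beta in *. pose proof (pow_le r (S j) Hr) as Hpw.
      specialize (Hd j). pose proof (Hp (S j)). specialize (HV1 (S j)).
      pose proof (pos_INR (S j)).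
      assert (0 <= V (S j) * u (S (S j))) by (apply Rmult_le_pos; lra).
      change (r ^ S (S j)) with (r * r ^ S j).
      set (p := r ^ S j) in *. set (X := V (S j) * u (S (S j))) in *.
      apply Rle_trans with (p * X).
      - assert (0 <= p * X * (1 - r)) by (apply Rmult_le_pos; [apply Rmult_le_pos |]; lra).
        unfold X in *. lra.
      - apply Rle_trans with (p * (V j * u (S j))); [| right; ring].
        apply Rmult_le_compat_l; auto. }
  destruct Hu as [Hp _].
  unfold real_poly, Re, Im; cbn [fst snd].
  rewrite !(decomp_sum _ (S N)) by lia. cbn [pred].
  change (z ^ 0)%C with (RtoC 1). cbn [fst snd RtoC].
  rewrite (sum_eq (fun i => u (S i) * fst (z ^ S i)%C)
     (fun j => (u (S j) * r ^ S j) * cos (INR (S j) * t))).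
  2:{ intros j _. rewrite Hzt, polar_pow. cbn [fst]. ring. }
  rewrite (sum_eq (fun i => u (S i) * snd (z ^ S i)%C)
     (fun j => (u (S j) * r ^ S j) * sin (INR (S j) * t))).
  2:{ intros j _. rewrite Hzt, polar_pow. cbn [snd]. ring. }
  pose proof (weighted_cos_sum_nonneg V (fun j => u (S j) * r ^ S j) N t HV Hw Ht) as HC.
  pose proof (weighted_sin_sum_nonneg V (fun j => u (S j) * r ^ S j) N t HV Hw Ht) as HS.
  cbv beta in HC. simpl (r ^ 1) in HC. specialize (Hp 0%nat). cbv beta in Hp.
  assert (Hu1 : u 1%nat * (r * 1) < u 0%nat) by nra.
  split; [lra | rewrite Rmult_0_r, Rplus_0_l; exact HS].
Qed.

(** * The binomial series in the unit disk *)

(** A multiple of [q^k] by [k + 1] is at most the geometric sum up to [k]. *)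
Lemma linear_times_geometric_bounded (q : R) (k : nat) :
  0 <= q < 1 -> (INR k + 1) * q ^ k <= / (1 - q).
Proof.
  intros Hq.
  assert (H : (INR k + 1) * q ^ k * (1 - q) <= 1 - q ^ S k).
  { induction k as [|k IH].
    - simpl. lra.
    - rewrite S_INR. simpl pow in *.
      assert (Hp : 0 <= q ^ k) by (apply pow_le; lra).
      assert (Hp1 : q ^ k <= 1) by (rewrite <- (pow1 k); apply pow_incr; lra).
      set (p := q ^ k) in *.
      assert (0 <= q * p <= 1) by nra.
      assert (q * ((INR k + 1) * p * (1 - q)) <= q * (1 - q * p)) by (apply Rmult_le_compat_l; lra).
      assert (0 <= (1 - q) * (1 - q * p)) by (apply Rmult_le_pos; lra).
      nra. }
  apply Rmult_le_reg_r with (1 - q); [lra |].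
  rewrite Rinv_l by lra.
  assert (0 <= q ^ S k) by (apply pow_le; lra). lra.
Qed.

Definition binomial_coef (s : R) (k : nat) : R := pochhammer s k / INR (fact k).

Lemma binomial_coef_S (s : R) (k : nat) :
  (INR k + 1) * binomial_coef s (S k) = (s + INR k) * binomial_coef s k.
Proof.
  unfold binomial_coef. rewrite fact_simpl, mult_INR, S_INR. simpl pochhammer.
  pose proof (pos_INR k). pose proof (INR_fact_neq_0 k). field. split; lra.
Qed.

Lemma binomial_coef_pos (s : R) (k : nat) : 0 < s -> 0 < binomial_coef s k.
Proof.
  intros Hs. apply Rdiv_lt_0_compat; [| apply INR_fact_lt_0].
  induction k as [|k IH]; simpl; [lra |].
  pose proof (pos_INR k). apply Rmult_lt_0_compat; lra.
Qed.

Lemma binomial_coef_le (s : R) (k : nat) : 0 < s <= 2 -> binomial_coef s k <= INR k + 1.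
Proof.
  intros Hs. induction k as [|k IH].
  - unfold binomial_coef. simpl. lra.
  - pose proof (binomial_coef_S s k) as H. pose proof (pos_INR k).
    pose proof (binomial_coef_pos s k ltac:(lra)).
    rewrite S_INR. apply Rmult_le_reg_l with (INR k + 1); [lra |]. rewrite H. nra.
Qed.

(** The binomial coefficients grow at most linearly because [s <= 2], so a radius
    slightly larger than 1 still gives bounded terms. *)
Lemma CV_radius_binomial (s : R) (z : C) (c : nat -> R) :
  0 < s <= 2 -> disk z -> (forall k, Rabs (c k) <= Cmod z ^ k) ->
  Rbar_lt 1 (CV_radius (fun k => binomial_coef s k * c k)).
Proof.
  intros Hs Hz Hc. unfold disk in Hz. pose proof (Cmod_ge_0 z) as Hr.
  set (r := Cmod z) in *. set (r0 := 2 / (1 + r)).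
  assert (Hr0 : 1 < r0) by (apply Rlt_div_r; lra).
  assert (Hq : 0 <= r * r0 < 1).
  { split; [apply Rmult_le_pos; lra |]. unfold r0.
    replace (r * (2 / (1 + r))) with (2 * r / (1 + r)) by (field; lra).
    apply Rlt_div_l; lra. }
  (* r0 = 2 / (1 + r) satisfies both 1 < r0 and r * r0 < 1. *)
  apply Rbar_lt_le_trans with r0; [exact Hr0 |].
  apply (proj1 (CV_radius_bounded (fun k => binomial_coef s k * c k))).
  exists (/ (1 - r * r0)). intros k.
  apply Rle_trans with (2 := linear_times_geometric_bounded _ k Hq).
  rewrite !Rabs_mult, Rpow_mult_distr, <- Rmult_assoc.
  rewrite (Rabs_pos_eq (r0 ^ k)) by (apply pow_le; lra).
  apply Rmult_le_compat_r; [apply pow_le; lra |].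
  rewrite Rabs_pos_eq by (apply Rlt_le, binomial_coef_pos; lra).
  apply Rmult_le_compat; auto using Rabs_pos, binomial_coef_le.
  apply Rlt_le, binomial_coef_pos; lra.
Qed.

(** The real part of [(1 - t z) G' = s z G], for [G t = sum_k b_k z^k t^k] and
    [z = x + i y]; [a] and [c] are the coefficients of the real and imaginary
    parts of [G].  Applied to [(c, a)] with [- y] it gives the imaginary part. *)
Lemma binomial_ray_ode (s x y : R) (a c : nat -> R) (t : R) :
  Rbar_lt (Rabs t) (CV_radius a) -> Rbar_lt (Rabs t) (CV_radius c) ->
  (forall k, (INR k + 1) * a (S k) = (s + INR k) * (x * a k - y * c k)) ->
  PSeries (PS_derive a) t
  = s * (x * PSeries a t - y * PSeries c t)
    + t * (x * PSeries (PS_derive a) t - y * PSeries (PS_derive c) t).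
Proof.
  intros Ha Hc Hrec.
  apply is_pseries_unique.
  assert (Hsa := PSeries_correct _ _ (CV_radius_inside _ _ Ha)).
  assert (Hsc := PSeries_correct _ _ (CV_radius_inside _ _ Hc)).
  assert (Hda := PSeries_correct _ _ (ex_pseries_derive _ _ Ha)).
  assert (Hdc := PSeries_correct _ _ (ex_pseries_derive _ _ Hc)).
  set (A := PSeries a t) in *. set (B := PSeries c t) in *.
  set (A' := PSeries (PS_derive a) t) in *. set (B' := PSeries (PS_derive c) t) in *.
  assert (Hlin : forall (p q : nat -> R) (P Q : R), is_pseries p t P -> is_pseries q t Q ->
     is_pseries (fun k => x * p k - y * q k) t (x * P - y * Q)).
  { intros p q P Q HP HQ. apply is_pseries_R. apply is_pseries_R in HP, HQ.
    apply (is_series_ext (fun k => x * (p k * t ^ k) - y * (q k * t ^ k))); [intros k; simpl; ring |].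
    apply (is_series_minus (fun k => x * (p k * t ^ k)) (fun k => y * (q k * t ^ k)));
      apply (is_series_scal_l (V := R_NormedModule)); assumption. }
  pose proof (Hlin _ _ _ _ Hsa Hsc) as H1.
  pose proof (is_pseries_incr_1 _ _ _ (Hlin _ _ _ _ Hda Hdc)) as H2.
  apply is_pseries_R in H1. apply is_pseries_R in H2. apply is_pseries_R.
  apply (is_series_scal_l (V := R_NormedModule) s) in H1.
  eapply is_series_ext; [| exact (is_series_plus _ _ _ _ H1 H2)].
  intros k. unfold PS_derive, PS_incr_1.
  change (s * ((x * a k - y * c k) * t ^ k)
     + match k with O => 0 | S n => x * (INR (S n) * a (S n)) - y * (INR (S n) * c (S n)) end * t ^ k
     = INR (S k) * a (S k) * t ^ k).
  rewrite (S_INR k), Hrec. destruct k; simpl INR; ring.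
Qed.

Lemma pow_n_Cpow (z : C) (k : nat) : @pow_n C_Ring z k = (z ^ k)%C.
Proof. induction k as [|k IH]; [reflexivity | simpl; rewrite IH; reflexivity]. Qed.

(** The uniform structure of [C] is that of the product, so convergence is
    componentwise. *)
Lemma is_series_C (f : nat -> C) (l : C) :
  is_series (fun k => Re (f k)) (Re l) -> is_series (fun k => Im (f k)) (Im l) ->
  @is_series C_AbsRing C_NormedModule f l.
Proof.
  intros HR HI.
  assert (Hsum : forall N, sum_n f N
     = (sum_n (fun k => Re (f k)) N, sum_n (fun k => Im (f k)) N)).
  { induction N as [|N IH].
    - rewrite !sum_O. apply surjective_pairing.
    - rewrite !sum_Sn, IH. reflexivity. }
  apply filterlim_locally. intros eps.
  pose proof (proj1 (filterlim_locally _ _) HR eps) as HR'.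
  pose proof (proj1 (filterlim_locally _ _) HI eps) as HI'.
  generalize (filter_and _ _ HR' HI'). apply filter_imp.
  intros N [H1 H2]. rewrite Hsum. split; assumption.
Qed.

(** Together with [is_derive_ray_arg] this says that the logarithm of [1 - t z] has
    derivative [- z / (1 - t z)]. *)
Lemma is_derive_ray_ln_Cmod (x y t : R) :
  0 < 1 - t * x ->
  is_derive (fun t => ln (Cmod (1 - t * x, - (t * y)))) t
    (- ((1 - t * x) * x - t * y * y) / ((1 - t * x) ^ 2 + (t * y) ^ 2)).
Proof.
  intros Hx. unfold Cmod; simpl.
  auto_derive.
  - assert (0 < (1 - t * x) * (1 - t * x)) by nra.
    split; [| split; [| trivial]].
    + nra.
    + apply sqrt_lt_R0. nra.
  - match goal with |- context [sqrt ?e] => set (Q := e) in * end.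
    assert (HQ : 0 < Q).
    { unfold Q. assert (0 < (1 - t * x) * (1 - t * x)) by nra. nra. }
    replace ((1 - t * x) * ((1 - t * x) * 1) + t * y * (t * y * 1)) with Q by (unfold Q; ring).
    assert (E : / (2 * sqrt Q) * / sqrt Q = / (2 * Q)).
    { pose proof (sqrt_lt_R0 Q HQ). rewrite <- Rinv_mult, Rmult_assoc, sqrt_sqrt; lra. }
    rewrite Rmult_assoc, E. field. lra.
Qed.

Lemma is_derive_ray_arg (x y t : R) :
  0 < 1 - t * x ->
  is_derive (fun t => atan (- (t * y) / (1 - t * x))) t
    (- y / ((1 - t * x) ^ 2 + (t * y) ^ 2)).
Proof.
  intros Hx. auto_derive; [lra |].
  assert (0 < (1 - t * x) ^ 2) by nra. field. split; nra.
Qed.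

(** The product of [U + i W] and [exp (s (rho + i phi))] has derivative 0, since
    the logarithmic derivatives of the two factors are opposite. *)
Lemma rotation_constant (s x y : R) (U W dU dW rho phi : R -> R) :
  (forall t, 0 <= t <= 1 ->
     is_derive U t (dU t) /\ is_derive W t (dW t) /\
     dU t = s * (x * U t - y * W t) + t * (x * dU t - y * dW t) /\
     dW t = s * (x * W t + y * U t) + t * (x * dW t + y * dU t) /\
     0 < 1 - t * x /\
     is_derive rho t (- ((1 - t * x) * x - t * y * y) / ((1 - t * x) ^ 2 + (t * y) ^ 2)) /\
     is_derive phi t (- y / ((1 - t * x) ^ 2 + (t * y) ^ 2))) ->
  U 0 = 1 -> W 0 = 0 -> rho 0 = 0 -> phi 0 = 0 ->
  exp (s * rho 1) * (U 1 * cos (s * phi 1) - W 1 * sin (s * phi 1)) = 1 /\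
  exp (s * rho 1) * (U 1 * sin (s * phi 1) + W 1 * cos (s * phi 1)) = 0.
Proof.
  intros H HU0 HW0 Hr0 Hp0.
  assert (Hder : forall t, 0 <= t <= 1 ->
    is_derive (fun t => exp (s * rho t) * (U t * cos (s * phi t) - W t * sin (s * phi t))) t 0 /\
    is_derive (fun t => exp (s * rho t) * (U t * sin (s * phi t) + W t * cos (s * phi t))) t 0).
  { intros t Ht. destruct (H t Ht) as (HU & HW & E1 & E2 & Hx & Hr & Hp).
    set (Q := (1 - t * x) ^ 2 + (t * y) ^ 2) in *.
    assert (HQ : 0 < Q) by (unfold Q; nra).
    set (r' := - ((1 - t * x) * x - t * y * y) / Q) in *. set (p' := - y / Q) in *.
    (* F1 and F2 are the real and imaginary parts of G' = - s (rho' + i phi') G,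
       obtained by solving the linear system for the derivatives of U and W. *)
    assert (F1 : dU t + s * (r' * U t - p' * W t) = 0).
    { assert (G1 : (1 - t * x) * dU t + t * y * dW t = s * (x * U t - y * W t)) by lra.
      assert (G2 : (1 - t * x) * dW t - t * y * dU t = s * (x * W t + y * U t)) by lra.
      assert (HdU : Q * dU t = (1 - t * x) * (s * (x * U t - y * W t))
                      - t * y * (s * (x * W t + y * U t)))
        by (rewrite <- G1, <- G2; unfold Q; ring).
      replace (dU t) with (((1 - t * x) * (s * (x * U t - y * W t))
                      - t * y * (s * (x * W t + y * U t))) / Q)
        by (rewrite <- HdU; field; lra).
      unfold r', p'. field. lra. }
    assert (F2 : dW t + s * (r' * W t + p' * U t) = 0).
    { assert (G1 : (1 - t * x) * dU t + t * y * dW t = s * (x * U t - y * W t)) by lra.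
      assert (G2 : (1 - t * x) * dW t - t * y * dU t = s * (x * W t + y * U t)) by lra.
      assert (HdW : Q * dW t = (1 - t * x) * (s * (x * W t + y * U t))
                      + t * y * (s * (x * U t - y * W t)))
        by (rewrite <- G1, <- G2; unfold Q; ring).
      replace (dW t) with (((1 - t * x) * (s * (x * W t + y * U t))
                      + t * y * (s * (x * U t - y * W t))) / Q)
        by (rewrite <- HdW; field; lra).
      unfold r', p'. field. lra. }
    clearbody r' p'.
    assert (XU : ex_derive U t) by (eexists; eassumption).
    assert (XW : ex_derive W t) by (eexists; eassumption).
    assert (Xr : ex_derive rho t) by (eexists; eassumption).
    assert (Xp : ex_derive phi t) by (eexists; eassumption).
    apply is_derive_unique in HU, HW, Hr, Hp.
    split; auto_derive; auto 10;
    change (fun x => U x) with U; change (fun x => W x) with W;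
    change (fun x => rho x) with rho; change (fun x => phi x) with phi;
    rewrite HU, HW, Hr, Hp.
    - replace 0 with (exp (s * rho t) *
        (cos (s * phi t) * (dU t + s * (r' * U t - p' * W t))
         - sin (s * phi t) * (dW t + s * (r' * W t + p' * U t)))) by (rewrite F1, F2; ring).
      ring.
    - replace 0 with (exp (s * rho t) *
        (sin (s * phi t) * (dU t + s * (r' * U t - p' * W t))
         + cos (s * phi t) * (dW t + s * (r' * W t + p' * U t)))) by (rewrite F1, F2; ring).
      ring. }
  split.
  - rewrite <- (eq_is_derive (V := R_NormedModule) _ 0 1 (fun t Ht => proj1 (Hder t Ht))) by lra.
    rewrite HU0, HW0, Hr0, Hp0, Rmult_0_r, exp_0, cos_0. ring.
  - rewrite <- (eq_is_derive (V := R_NormedModule) _ 0 1 (fun t Ht => proj2 (Hder t Ht))) by lra.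
    rewrite HU0, HW0, Hr0, Hp0, Rmult_0_r, exp_0, sin_0. ring.
Qed.

Lemma binomial_series_disk (s : R) (z : C) :
  0 < s <= 2 -> disk z ->
  @is_pseries C_AbsRing C_NormedModule (fun k => RtoC (binomial_coef s k)) z
    (/ Cpower_rhp (RtoC 1 - z) s)%C.
Proof.
  intros Hs Hz.
  set (x := Re z). set (y := Im z).
  set (a := fun k => binomial_coef s k * Re (z ^ k)%C).
  set (c := fun k => binomial_coef s k * Im (z ^ k)%C).
  assert (Hx : Rabs x < 1) by (eapply Rle_lt_trans; [apply re_le_Cmod | exact Hz]).
  apply Rabs_lt_between in Hx.
  assert (Ha : Rbar_lt 1 (CV_radius a)).
  { apply (CV_radius_binomial s z); auto. intros k. rewrite <- Cmod_pow. apply re_le_Cmod. }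
  assert (Hc : Rbar_lt 1 (CV_radius c)).
  { apply (CV_radius_binomial s z); auto. intros k. rewrite <- Cmod_pow. eapply Rle_trans; [apply Rmax_r | apply Rmax_Cmod]. }
  assert (Hin : forall t p, 0 <= t <= 1 -> Rbar_lt 1 (CV_radius p) ->
    Rbar_lt (Rabs t) (CV_radius p)).
  { intros t p Ht. apply Rbar_le_lt_trans. rewrite Rabs_pos_eq by lra. apply Ht. }
  assert (Hreca : forall k, (INR k + 1) * a (S k) = (s + INR k) * (x * a k - y * c k)).
  { intros k. unfold a, c. rewrite <- Rmult_assoc, binomial_coef_S.
    cbn [Cpow]. unfold Cmult, Re, Im, x, y; cbn [fst snd]. unfold Re, Im. ring. }
  assert (Hrecc : forall k, (INR k + 1) * c (S k) = (s + INR k) * (x * c k - - y * a k)).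
  { intros k. unfold a, c. rewrite <- Rmult_assoc, binomial_coef_S.
    cbn [Cpow]. unfold Cmult, Re, Im, x, y; cbn [fst snd]. unfold Re, Im. ring. }
  assert (Ha0 : a 0%nat = 1) by (unfold a, binomial_coef; simpl; field).
  assert (Hc0 : c 0%nat = 0) by (unfold c, binomial_coef; simpl; field).
  destruct (rotation_constant s x y (PSeries a) (PSeries c)
     (PSeries (PS_derive a)) (PSeries (PS_derive c))
     (fun t => ln (Cmod (1 - t * x, - (t * y))))
     (fun t => atan (- (t * y) / (1 - t * x)))) as [E1 E2].
  - intros t Ht. pose proof (Hin t a Ht Ha) as Hat. pose proof (Hin t c Ht Hc) as Hct.
    assert (Htx : 0 < 1 - t * x) by nra.
    refine (conj _ (conj _ (conj _ (conj _ (conj _ (conj _ _))))));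
      auto using is_derive_PSeries, is_derive_ray_ln_Cmod, is_derive_ray_arg.
    + apply (binomial_ray_ode s x y a c t); auto.
    + rewrite (binomial_ray_ode s x (- y) c a t) at 1; auto. ring.
  - rewrite PSeries_0. exact Ha0.
  - rewrite PSeries_0. exact Hc0.
  - rewrite !Rmult_0_l, Rminus_0_r, Ropp_0. change (1, 0) with (RtoC 1).
    rewrite Cmod_1. apply ln_1.
  - rewrite !Rmult_0_l, Ropp_0, Rdiv_0_l. apply atan_0.
  - cbv beta in E1, E2. rewrite !Rmult_1_l in E1, E2.
    assert (Hw : (RtoC 1 - z)%C = (1 - x, - y)).
    { unfold Cminus, Cplus, Copp, RtoC, x, y, Re, Im; simpl. f_equal; ring. }
    assert (Hinv : (/ Cpower_rhp (RtoC 1 - z) s)%C = (PSeries a 1, PSeries c 1)).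
    { rewrite Hw. unfold Cpower_rhp, Clog_rhp, Cexp. rewrite RtoC_mult_components.
      unfold Re, Im; cbn [fst snd].
      set (U := PSeries a 1) in *. set (W := PSeries c 1) in *.
      set (r := s * ln _) in *. set (p := s * atan _) in *.
      assert (Hprod : Cmult (U, W) (exp r * cos p, exp r * sin p) = RtoC 1).
      { unfold Cmult, RtoC; cbn [fst snd]. f_equal; [rewrite <- E1 | rewrite <- E2]; ring. }
      assert (Hnz : (exp r * cos p, exp r * sin p) <> RtoC 0).
      { intros H0. rewrite H0, Cmult_0_r in Hprod. apply RtoC_inj in Hprod. lra. }
      rewrite <- (Cmult_1_l (/ _)%C), <- Hprod.
      rewrite <- Cmult_assoc, Cinv_r by exact Hnz. apply Cmult_1_r. }
    rewrite Hinv.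
    assert (Hsa := PSeries_correct _ _ (CV_radius_inside a 1 (Hin 1 a ltac:(lra) Ha))).
    assert (Hsc := PSeries_correct _ _ (CV_radius_inside c 1 (Hin 1 c ltac:(lra) Hc))).
    apply is_pseries_R in Hsa, Hsc.
    apply is_series_C; cbn [Re Im fst snd]; [eapply is_series_ext; [| exact Hsa] | eapply is_series_ext; [| exact Hsc]];
    intros k; unfold scal; cbn; rewrite pow1, Rmult_1_r, pow_n_Cpow; unfold a, c, Re, Im; cbn; ring.
Qed.

Lemma koebe_expansion (gamma : R) :
  0 <= gamma < 1 ->
  has_expansion (koebe gamma)
    (fun k => match k with
              | O => RtoC 0
              | S j => RtoC (binomial_coef (2 - 2 * gamma) j)
              end).
Proof.
  intros Hg z Hz.
  pose proof (is_pseries_incr_1 _ _ _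
    (binomial_series_disk (2 - 2 * gamma) z ltac:(lra) Hz)) as H.
  apply (is_pseries_ext _ _ _ _ (fun k => match k with O => eq_refl | S _ => eq_refl end) H).
Qed.

(** * A quadratic inequality for three-term polynomials *)

Lemma quad_nonneg (A B C y : R) : 0 <= A -> 0 <= C -> 0 <= y ->
  (0 <= B \/ B ^ 2 <= 4 * A * C) -> 0 <= A * y ^ 2 + B * y + C.
Proof.
  intros HA HC Hy [HB | HB].
  - assert (0 <= y ^ 2) by nra. assert (0 <= A * y ^ 2) by (apply Rmult_le_pos; lra).
    assert (0 <= B * y) by (apply Rmult_le_pos; lra). lra.
  - destruct (Req_dec A 0) as [-> | HA0].
    + assert (B = 0) by nra. subst. lra.
    + assert (0 <= 4 * A * (A * y ^ 2 + B * y + C)).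
      { replace (4 * A * (A * y ^ 2 + B * y + C)) with ((2 * A * y + B) ^ 2 + (4 * A * C - B ^ 2)) by ring.
        pose proof (pow2_ge_0 (2 * A * y + B)). lra. }
      apply Rmult_le_reg_l with (4 * A); lra.
Qed.

(** The expression is affine in [(sigma, tau)], which ranges over the triangle with
    vertices [(0, 0)], [(1/2, 1/3)] and [(1/2, 1/4)].  At each vertex it is a
    quadratic polynomial in [1 + x], nonnegative by its coefficients for small
    [k] and by its discriminant for large [k]. *)
Lemma quotient_quadratic_boundary (k x sigma tau : R) :
  0 <= k <= 5 / 7 -> -1 <= x <= 0 -> 0 <= sigma <= 1 / 2 -> sigma / 2 <= tau <= 2 * sigma / 3 ->
  0 <= (1 - k + x + 2 * k * x ^ 2) + sigma * (1 + x + x * k)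
       + tau * (k ^ 2 - k + x * k + 2 * k * x ^ 2).
Proof.
  intros Hk Hx Hs Ht.
  set (G := fun sg ta => (1 - k + x + 2 * k * x ^ 2) + sg * (1 + x + x * k)
       + ta * (k ^ 2 - k + x * k + 2 * k * x ^ 2)).
  change (0 <= G sigma tau).
  assert (G0 : 0 <= G 0 0).
  { unfold G. replace (_ + _ + _) with (2 * k * (1 + x) ^ 2 + (1 - 4 * k) * (1 + x) + k) by ring.
    apply quad_nonneg; [lra | lra | lra |].
    destruct (Rle_lt_dec k (1/4)); [left; lra | right; nra]. }
  assert (G1 : 0 <= G (1 / 2) (1 / 3)).
  { unfold G. replace (_ + _ + _) with (8 / 3 * k * (1 + x) ^ 2 + (3 / 2 - 9 / 2 * k) * (1 + x) + (k / 2 + k ^ 2 / 3)) by field.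
    apply quad_nonneg; [nra | nra | lra |].
    destruct (Rle_lt_dec k (1/3)); [left; lra | right; nra]. }
  assert (G2 : 0 <= G (1 / 2) (1 / 4)).
  { unfold G. replace (_ + _ + _) with (5 / 2 * k * (1 + x) ^ 2 + (3 / 2 - 17 / 4 * k) * (1 + x) + (k / 2 + k ^ 2 / 4)) by field.
    apply quad_nonneg; [nra | nra | lra |].
    destruct (Rle_lt_dec k (1/3)); [left; lra | right; nra]. }
  replace (G sigma tau) with ((1 - 2 * sigma) * G 0 0 + (12 * tau - 6 * sigma) * G (1 / 2) (1 / 3)
     + (8 * sigma - 12 * tau) * G (1 / 2) (1 / 4)) by (unfold G; field).
  assert (0 <= (1 - 2 * sigma) * G 0 0) by (apply Rmult_le_pos; lra).
  assert (0 <= (12 * tau - 6 * sigma) * G (1 / 2) (1 / 3)) by (apply Rmult_le_pos; lra).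
  assert (0 <= (8 * sigma - 12 * tau) * G (1 / 2) (1 / 4)) by (apply Rmult_le_pos; lra).
  lra.
Qed.

(** With [s = k t] the expression is [1 + b t + c t^2].  For [x < 0] one has
    [c <= 1], so nonnegativity at [t = 1] gives positivity for [t < 1]: the
    polynomial is at least [(1 - t) (1 - c t)]. *)
Lemma quotient_quadratic_pos (t s x sigma tau : R) :
  0 <= t < 1 -> 0 <= s <= 5 / 7 * t -> -1 <= x <= 1 ->
  0 <= sigma <= 1 / 2 -> sigma / 2 <= tau <= 2 * sigma / 3 ->
  0 < 1 + t ^ 2 * sigma + s ^ 2 * tau - s * (1 + tau)
      + x * t * (1 + sigma + s * (tau + sigma)) + 2 * s * (1 + tau) * x ^ 2.
Proof.
  intros Ht Hs Hx Hsg Hta.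
  assert (Hx2 : 0 <= 2 * s * (1 + tau) * x ^ 2)
    by (apply Rmult_le_pos; [| apply pow2_ge_0]; apply Rmult_le_pos; lra).
  destruct (Rle_lt_dec 0 x) as [Hx0 | Hx0].
  - assert (0 <= t ^ 2 * sigma) by (apply Rmult_le_pos; [apply pow2_ge_0 | lra]).
    assert (0 <= s ^ 2 * tau) by (apply Rmult_le_pos; [apply pow2_ge_0 | lra]).
    assert (s * (1 + tau) < 1) by nra.
    assert (0 <= x * t * (1 + sigma + s * (tau + sigma))).
    { apply Rmult_le_pos; [apply Rmult_le_pos; lra |].
      assert (0 <= s * (tau + sigma)) by (apply Rmult_le_pos; lra). lra. }
    lra.
  - destruct (Req_dec t 0) as [-> | Ht0].
    { replace s with 0 by lra. lra. }
    set (k := s / t).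
    assert (Hsk : s = k * t) by (unfold k; field; lra).
    assert (Hk : 0 <= k <= 5 / 7).
    { split; [apply Rdiv_le_0_compat; lra | apply Rle_div_l; lra]. }
    clearbody k. subst s.
    pose proof (quotient_quadratic_boundary k x sigma tau Hk ltac:(lra) Hsg Hta) as HG.
    set (c := sigma + k ^ 2 * tau + k * x * (tau + sigma)).
    set (b := x * (1 + sigma) + k * (1 + tau) * (2 * x ^ 2 - 1)).
    assert (Hc : c <= 1).
    { unfold c. assert (0 <= k * (- x) * (tau + sigma)) by (repeat apply Rmult_le_pos; lra).
      assert (k ^ 2 <= 1) by nra. assert (k ^ 2 * tau <= 1 * tau) by (apply Rmult_le_compat_r; lra). lra. }
    assert (Hbc : 0 <= 1 + b + c) by (unfold b, c; lra).
    replace (_ + _ + _) with (1 + b * t + c * t ^ 2) by (unfold b, c; ring).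
    assert (0 <= t * (1 + b + c)) by (apply Rmult_le_pos; lra).
    assert (0 < (1 - t) * (1 - c * t)) by (apply Rmult_lt_0_compat; nra).
    lra.
Qed.

(** * Calculus of polynomials vanishing at the origin, and starlikeness *)

Lemma real_poly_S (u : nat -> R) (N : nat) (z : C) :
  real_poly u (S N) z = (real_poly u N z + RtoC (u (S N)) * z ^ S N)%C.
Proof. rewrite RtoC_mult_components. reflexivity. Qed.

Lemma real_poly_0 (u : nat -> R) (z : C) : real_poly u 0 z = RtoC (u 0%nat).
Proof. unfold real_poly, RtoC, Re, Im; simpl. f_equal; ring. Qed.

(** The two normed modules differ only in the uniform structure, and the definition
    of the derivative refers to the target only through its norm. *)
Lemma is_derive_C_of_AbsRing (f : C -> C) (z l : C) :
  @is_derive C_AbsRing (AbsRing_NormedModule C_AbsRing) f z l ->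
  @is_derive C_AbsRing C_NormedModule f z l.
Proof.
  intros [[H1 H2 H3] Hd]. split.
  - constructor; [exact H1 | exact H2 | exact H3].
  - intros x Hx. exact (Hd x Hx).
Qed.

Lemma is_derive_monomial (c : R) (k : nat) (z : C) :
  @is_derive C_AbsRing C_NormedModule (fun w => RtoC c * w ^ S k)%C z
    (RtoC ((INR k + 1) * c) * z ^ k)%C.
Proof.
  assert (H : @is_derive C_AbsRing (AbsRing_NormedModule C_AbsRing) (fun w => w ^ S k)%C z
     (RtoC (INR k + 1) * z ^ k)%C).
  { induction k as [|k IH].
    - apply (is_derive_ext (fun w : C_AbsRing => w)).
      { intros w. simpl. symmetry. apply Cmult_1_r. }
      replace (RtoC (INR 0 + 1) * z ^ 0)%C with (@one C_AbsRing)
        by (simpl; rewrite Rplus_0_l, Cmult_1_r; reflexivity).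
      apply is_derive_id.
    - pose proof (is_derive_mult (K := C_AbsRing) (fun w => w) (fun w => w ^ S k)%C z _ _
        (is_derive_id z) IH Cmult_comm) as H.
      replace (RtoC (INR (S k) + 1) * z ^ S k)%C with
        (plus (mult (@one C_AbsRing) (z ^ S k)%C) (mult z (RtoC (INR k + 1) * z ^ k)%C) : C_AbsRing).
      + exact H.
      + rewrite S_INR, (RtoC_plus (INR k + 1)).
        change (1 * z ^ S k + z * (RtoC (INR k + 1) * z ^ k) = (RtoC (INR k + 1) + 1) * z ^ S k)%C.
        simpl Cpow. ring. }
  pose proof (is_derive_mult (K := C_AbsRing) (fun _ => RtoC c) (fun w => w ^ S k)%C z _ _
        (is_derive_const _ z) H Cmult_comm) as H'.
  replace (RtoC ((INR k + 1) * c) * z ^ k)%C with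
    (plus (mult (@zero C_AbsRing) (z ^ S k)%C) (mult (RtoC c) (RtoC (INR k + 1) * z ^ k)%C) : C_AbsRing).
  - apply is_derive_C_of_AbsRing. exact H'.
  - change (0 * z ^ S k + RtoC c * (RtoC (INR k + 1) * z ^ k) = RtoC ((INR k + 1) * c) * z ^ k)%C.
    rewrite RtoC_mult. ring.
Qed.

Lemma is_derive_shifted_poly (u : nat -> R) (N : nat) (z : C) :
  @is_derive C_AbsRing C_NormedModule (fun w => w * real_poly u N w)%C z
    (real_poly (fun k => (INR k + 1) * u k) N z).
Proof.
  induction N as [|N IH].
  - rewrite real_poly_0.
    apply (is_derive_ext (fun w => RtoC (u 0%nat) * w ^ 1)%C).
    { intros w. rewrite real_poly_0. simpl. rewrite Cmult_1_r. apply Cmult_comm. }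
    pose proof (is_derive_monomial (u 0%nat) 0 z) as H.
    simpl Cpow in H at 2. rewrite Cmult_1_r in H. exact H.
  - rewrite real_poly_S.
    apply (is_derive_ext (fun w => plus (w * real_poly u N w)%C (RtoC (u (S N)) * w ^ S (S N))%C)).
    { intros w. rewrite real_poly_S. simpl Cpow. unfold plus; simpl. ring. }
    apply (is_derive_plus (V := C_NormedModule)); [exact IH | apply is_derive_monomial].
Qed.

Lemma C_derive_shifted_poly (u : nat -> R) (N : nat) (z : C) :
  C_derive (fun w => w * real_poly u N w)%C z = real_poly (fun k => (INR k + 1) * u k) N z.
Proof. apply is_C_derive_unique, is_derive_shifted_poly. Qed.

Lemma shifted_poly_expansion (u : nat -> R) (N : nat) :
  (forall k, (N < k)%nat -> u k = 0) ->
  has_expansion (fun z => z * real_poly u N z)%C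
    (fun k => match k with O => RtoC 0 | S j => RtoC (u j) end).
Proof.
  intros Hu z _.
  assert (H : @is_pseries C_AbsRing C_NormedModule (fun k => RtoC (u k)) z (real_poly u N z)).
  { assert (Hsum : forall m, sum_n (fun k => @scal _ C_NormedModule (@pow_n C_Ring z k) (RtoC (u k))) (m + N)
        = real_poly u N z).
    { induction m as [|m IH].
      - simpl. clear Hu. induction N as [|N IH].
        + rewrite sum_O, real_poly_0. apply Cmult_1_l.
        + rewrite sum_Sn, IH, real_poly_S, pow_n_Cpow.
          unfold plus, scal; simpl. f_equal. apply Cmult_comm.
      - simpl. rewrite sum_Sn, IH, (Hu (S (m + N))) by lia.
        change (real_poly u N z + @pow_n C_Ring z (S (m + N)) * RtoC 0 = real_poly u N z)%C.
        ring. }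
    unfold is_pseries, is_series.
    apply (filterlim_ext_loc (fun _ => real_poly u N z)).
    - exists N. intros n Hn. rewrite <- (Hsum (n - N)%nat). f_equal. lia.
    - apply filterlim_const. }
  pose proof (is_pseries_incr_1 _ _ _ H) as H1.
  apply (is_pseries_ext _ _ _ _ (fun k => match k with O => eq_refl | S _ => eq_refl end) H1).
Qed.

Lemma shifted_poly_class_A0 (u : nat -> R) (N : nat) :
  u 0%nat = 1 -> class_A0 (fun z => z * real_poly u N z)%C.
Proof.
  intros H0. split; [| split].
  - intros z _. eexists. apply is_derive_shifted_poly.
  - apply Cmult_0_l.
  - rewrite C_derive_shifted_poly.
    induction N as [|N IH].
    + rewrite real_poly_0, H0. f_equal. simpl. ring.
    + rewrite real_poly_S, IH. simpl Cpow. ring.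
Qed.

Lemma real_poly_conj (u : nat -> R) (N : nat) (z : C) :
  real_poly u N (Cconj z) = Cconj (real_poly u N z).
Proof.
  assert (Hpow : forall k, (Cconj z ^ k)%C = Cconj (z ^ k)%C).
  { induction k as [|k IH]; [unfold Cconj; simpl; rewrite Ropp_0; reflexivity |].
    cbn [Cpow]. rewrite IH, Cmult_conj. reflexivity. }
  induction N as [|N IH].
  - rewrite !real_poly_0. unfold Cconj; simpl. rewrite Ropp_0. reflexivity.
  - rewrite !real_poly_S, IH, Hpow, Cplus_conj, Cmult_conj. f_equal. f_equal.
    unfold Cconj; simpl. rewrite Ropp_0. reflexivity.
Qed.

(** With [h z = z Q z] one has [z h'/h = P/Q + gamma], and the real part of [P/Q]
    has the sign of [Re P Re Q + Im P Im Q].  The lower half of the disk follows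
    by conjugation. *)
Lemma real_poly_starlike (gamma : R) (u : nat -> R) (N : nat) :
  0 <= gamma < 1 -> u 0%nat = 1 ->
  (forall z, disk z -> 0 <= Im z ->
     let P := real_poly (fun k => (INR k + 1 - gamma) * u k) N z in
     let Q := real_poly u N z in
     0 < Re P * Re Q + Im P * Im Q) ->
  starlike gamma (fun z => z * real_poly u N z)%C.
Proof.
  intros Hg H0 Hpos. split; [apply shifted_poly_class_A0; exact H0 |].
  intros z Hz Hz0.
  assert (Hall : 0 < Re (real_poly (fun k => (INR k + 1 - gamma) * u k) N z) * Re (real_poly u N z)
     + Im (real_poly (fun k => (INR k + 1 - gamma) * u k) N z) * Im (real_poly u N z)).
  { destruct (Rle_lt_dec 0 (Im z)) as [Hi | Hi]; [apply Hpos; auto |].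
    specialize (Hpos (Cconj z)). cbv zeta in Hpos. rewrite !real_poly_conj in Hpos.
    unfold disk in Hpos. rewrite Cmod_conj in Hpos.
    specialize (Hpos Hz). unfold Cconj, Re, Im in *; cbn [fst snd] in Hpos.
    specialize (Hpos ltac:(lra)). lra. }
  rewrite C_derive_shifted_poly.
  assert (HD : real_poly (fun k => (INR k + 1) * u k) N z
    = (real_poly (fun k => (INR k + 1 - gamma) * u k)%R N z + RtoC gamma * real_poly u N z)%C).
  { clear. induction N as [|N IH].
    - rewrite !real_poly_0, <- RtoC_mult, <- RtoC_plus. f_equal. ring.
    - rewrite !real_poly_S, IH.
      replace ((INR (S N) + 1) * u (S N)) with ((INR (S N) + 1 - gamma) * u (S N) + gamma * u (S N)) by ring.
      rewrite RtoC_plus, (RtoC_mult gamma). ring. }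
  rewrite HD. clear HD.
  set (P := real_poly (fun k => (INR k + 1 - gamma) * u k) N z) in *.
  set (Q := real_poly u N z) in *.
  assert (HQ : Q <> RtoC 0).
  { intros E. rewrite E in Hall. unfold RtoC, Re, Im in Hall; simpl in Hall. lra. }
  split; [apply Cmult_neq_0; auto |].
  replace (z * (P + RtoC gamma * Q) / (z * Q))%C with (P / Q + RtoC gamma)%C by (field; auto).
  assert (HQ2 : 0 < Re Q ^ 2 + Im Q ^ 2).
  { rewrite <- Cmod2_alt. apply pow_lt. apply Cmod_gt_0. exact HQ. }
  destruct P as [p1 p2]. destruct Q as [q1 q2]. unfold Re, Im in *; cbn [fst snd] in *.
  unfold Cdiv, Cinv, Cmult, Cplus, RtoC; cbn [fst snd].
  assert (HE : p1 * (q1 / (q1 ^ 2 + q2 ^ 2)) - p2 * (- q2 / (q1 ^ 2 + q2 ^ 2))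
     = (p1 * q1 + p2 * q2) / (q1 ^ 2 + q2 ^ 2)) by (field; lra).
  assert (0 < (p1 * q1 + p2 * q2) / (q1 ^ 2 + q2 ^ 2)) by (apply Rdiv_lt_0_compat; lra).
  lra.
Qed.

(** * Power weights *)

Lemma rpow_pos_eq (x y : R) : 0 < x -> rpow x y = Rpower x y.
Proof. intros Hx. unfold rpow. destruct (Req_EM_T x 0); [lra | reflexivity]. Qed.

Lemma rpow_ge_0 (x y : R) : 0 <= rpow x y.
Proof.
  unfold rpow. destruct (Req_EM_T x 0); [destruct (Req_EM_T y 0); lra |].
  apply Rlt_le, exp_pos.
Qed.

Lemma rpow_le_l (x y l : R) : 0 <= x <= y -> 0 <= l -> rpow x l <= rpow y l.
Proof.
  intros Hx Hl. unfold rpow at 1. destruct (Req_EM_T x 0) as [E | E].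
  - destruct (Req_EM_T l 0) as [-> | E']; [| apply rpow_ge_0].
    unfold rpow. destruct (Req_EM_T y 0).
    + destruct (Req_EM_T 0 0); lra.
    + unfold Rpower. rewrite Rmult_0_l, exp_0. lra.
  - rewrite rpow_pos_eq by lra. apply Rle_Rpower_l; lra.
Qed.

Definition power_weight (alpha beta l m x : R) : R :=
  Rpower (x + alpha) l * Rpower (x + beta) m.

(** The exponents are scaled so as to add up to 1.  The value at 0, the weight of
    the frequency 1, is set to 1 instead of the value of the power weight, as the
    second inequality of the chain is [W_2 u_2 <= u_1]. *)
Definition normalized_weight (alpha beta lambda mu : R) (j : nat) : R :=
  match j with
  | O => 1
  | S _ => power_weight alpha beta (lambda / (lambda + mu)) (mu / (lambda + mu)) (INR j + 1)
  end.

Lemma power_weight_pos (alpha beta l m x : R) : 0 < power_weight alpha beta l m x.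
Proof. apply Rmult_lt_0_compat; apply exp_pos. Qed.

Lemma power_weight_le (alpha beta l m x y : R) :
  0 <= alpha -> 0 <= beta ->
  0 <= l -> 0 <= m -> 0 < x <= y -> power_weight alpha beta l m x <= power_weight alpha beta l m y.
Proof.
  intros Ha Hb Hl Hm Hx. apply Rmult_le_compat; try (apply Rlt_le, exp_pos); apply Rle_Rpower_l; lra.
Qed.

Lemma power_weight_plus (alpha beta l m l' m' x : R) :
  power_weight alpha beta (l + l') (m + m') x
  = power_weight alpha beta l m x * power_weight alpha beta l' m' x.
Proof. unfold power_weight. rewrite !Rpower_plus. ring. Qed.

Lemma Rpower_mult_self (l m x : R) : 0 < x -> l + m = 1 ->
  Rpower x l * Rpower x m = x.
Proof. intros Hx Hlm. rewrite <- Rpower_plus, Hlm. apply Rpower_1; auto. Qed.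

Lemma power_weight_ge_id (alpha beta l m x : R) :
  0 <= alpha -> 0 <= beta ->
  0 <= l -> 0 <= m -> l + m = 1 -> 0 < x -> x <= power_weight alpha beta l m x.
Proof.
  intros Ha Hb Hl Hm Hlm Hx. rewrite <- (Rpower_mult_self l m x) at 1 by auto.
  apply Rmult_le_compat; try (apply Rlt_le, exp_pos); apply Rle_Rpower_l; lra.
Qed.

(** Each factor satisfies [(y + alpha) / (x + alpha) <= y / x], and the exponents add
    up to 1. *)
Lemma power_weight_sublinear (alpha beta l m x y : R) :
  0 <= alpha -> 0 <= beta ->
  0 <= l -> 0 <= m -> l + m = 1 -> 0 < x <= y ->
  power_weight alpha beta l m y * x <= power_weight alpha beta l m x * y.
Proof.
  intros Ha Hb Hl Hm Hlm Hx.
  replace (power_weight alpha beta l m y * x)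
    with (power_weight alpha beta l m y * (Rpower x l * Rpower x m))
    by (rewrite Rpower_mult_self; lra).
  replace (power_weight alpha beta l m x * y)
    with (power_weight alpha beta l m x * (Rpower y l * Rpower y m))
    by (rewrite Rpower_mult_self; lra).
  unfold power_weight.
  replace (Rpower (y + alpha) l * Rpower (y + beta) m * (Rpower x l * Rpower x m))
    with ((Rpower (y + alpha) l * Rpower x l) * (Rpower (y + beta) m * Rpower x m)) by ring.
  replace (Rpower (x + alpha) l * Rpower (x + beta) m * (Rpower y l * Rpower y m))
    with ((Rpower (x + alpha) l * Rpower y l) * (Rpower (x + beta) m * Rpower y m)) by ring.
  rewrite !Rpower_mult_distr by lra.
  apply Rmult_le_compat; try (apply Rlt_le, exp_pos); apply Rle_Rpower_l; nra.
Qed.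

(** Lowering the exponents divides the weight by a power weight with nonnegative
    exponents, which is nondecreasing; a ratio condition with the larger exponents
    therefore implies the one with the smaller ones. *)
Lemma power_weight_transfer (alpha beta l m l' m' x y X Y : R) :
  0 <= alpha -> 0 <= beta ->
  0 <= l' <= l -> 0 <= m' <= m -> 0 < x <= y -> 0 <= Y ->
  power_weight alpha beta l m y * X <= power_weight alpha beta l m x * Y ->
  power_weight alpha beta l' m' y * X <= power_weight alpha beta l' m' x * Y.
Proof.
  intros Ha Hb Hl Hm Hx HY H.
  replace l with (l' + (l - l')) in H by ring. replace m with (m' + (m - m')) in H by ring.
  rewrite !power_weight_plus in H.
  pose proof (power_weight_le alpha beta (l - l') (m - m') x y Ha Hb ltac:(lra) ltac:(lra) Hx) as HT.
  pose proof (power_weight_pos alpha beta (l - l') (m - m') y) as HTy.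
  pose proof (power_weight_pos alpha beta l' m' x) as HVx.
  set (Tx := power_weight _ _ (l - l') (m - m') x) in *.
  set (Ty := power_weight _ _ (l - l') (m - m') y) in *.
  set (Vx := power_weight _ _ l' m' x) in *. set (Vy := power_weight _ _ l' m' y) in *.
  apply Rmult_le_reg_l with Ty; [lra |].
  assert (Tx * (Vx * Y) <= Ty * (Vx * Y)).
  { apply Rmult_le_compat_r; [apply Rmult_le_pos |]; lra. }
  lra.
Qed.

Lemma power_weight_le_exponents (alpha beta l m l' m' x : R) :
  0 <= alpha -> 0 <= beta ->
  l' <= l -> m' <= m -> 1 <= x -> power_weight alpha beta l' m' x <= power_weight alpha beta l m x.
Proof.
  intros Ha Hb Hl Hm Hx. apply Rmult_le_compat; try (apply Rlt_le, exp_pos); apply Rle_Rpower; lra.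
Qed.

Lemma normalized_exponents (lambda mu : R) :
  0 <= lambda -> 0 <= mu -> 1 <= lambda + mu ->
  0 <= lambda / (lambda + mu) <= lambda /\ 0 <= mu / (lambda + mu) <= mu /\
  lambda / (lambda + mu) + mu / (lambda + mu) = 1.
Proof.
  intros Hl Hm Hlm.
  repeat split; try (apply Rdiv_le_0_compat; lra); try (apply Rle_div_l; nra). field. lra.
Qed.

Lemma normalized_weight_regular (alpha beta lambda mu : R) :
  0 <= alpha -> 0 <= beta -> 0 <= lambda -> 0 <= mu -> 1 <= lambda + mu ->
  regular_weight (normalized_weight alpha beta lambda mu).
Proof.
  intros Ha Hb Hl Hm Hlm.
  destruct (normalized_exponents lambda mu Hl Hm Hlm) as (Hl' & Hm' & Hlm').
  assert (Hge : forall j, INR j + 1 <= normalized_weight alpha beta lambda mu j).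
  { intros [|j]; cbn [normalized_weight]; [simpl; lra |].
    apply power_weight_ge_id; try lra. pose proof (pos_INR (S j)). lra. }
  split; [reflexivity | split; [exact Hge | split]].
  - intros [|j].
    + specialize (Hge 1%nat). cbn [normalized_weight] in *. simpl INR in *. lra.
    + cbn [normalized_weight]. pose proof (pos_INR (S j)). rewrite (S_INR (S j)).
      apply power_weight_le; lra.
  - intros [|j] Hj; [lia |]. cbn [normalized_weight].
    pose proof (pos_INR (S j)). rewrite (S_INR (S j)).
    replace (INR (S j) + 2) with (INR (S j) + 1 + 1) by ring.
    apply power_weight_sublinear; lra.
Qed.

(** * Coefficients of the polynomial and of the convolution *)

Lemma pochhammer_pos (x : R) (k : nat) : 0 < x -> 0 < pochhammer x k.
Proof.
  intros Hx. induction k as [|k IH]; simpl; [lra |].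
  pose proof (pos_INR k). apply Rmult_lt_0_compat; lra.
Qed.

Lemma cesaro_B_pos (b c : R) (k : nat) : 0 < c <= b -> 0 < cesaro_B b c k.
Proof.
  intros H. destruct k as [|k]; cbn [cesaro_B]; [lra |].
  apply Rmult_lt_0_compat; apply Rdiv_lt_0_compat; try lra; apply pochhammer_pos; lra.
Qed.

(** Because of the exceptional value of [cesaro_B] at 0, this quotient does not
    follow the rule of [cesaro_B_SS]. *)
Lemma cesaro_B_1 (b c : R) : 0 < c <= b -> cesaro_B b c 0 * (1 + b - c) = cesaro_B b c 1 * c.
Proof. intros H. simpl. field. lra. Qed.

Lemma cesaro_B_SS (b c : R) (i : nat) : 0 < c <= b ->
  cesaro_B b c (S i) * (b + INR i + 1) = cesaro_B b c (S (S i)) * (c + INR i + 1).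
Proof.
  intros H. unfold cesaro_B.
  change (pochhammer b (S (S i))) with (pochhammer b (S i) * (b + INR (S i))).
  change (pochhammer c (S (S i))) with (pochhammer c (S i) * (c + INR (S i))).
  pose proof (pochhammer_pos c (S i) ltac:(lra)). pose proof (pos_INR i).
  rewrite S_INR. field. lra.
Qed.

(** Cut off at [n], so that the inequalities between consecutive coefficients may be
    stated for all indices. *)
Definition cesaro_coef (n : nat) (b c : R) (k : nat) : R :=
  if (k <? n)%nat then cesaro_B b c (n - 1 - k) / cesaro_B b c (n - 1) else 0.

Lemma cesaro_coef_out (n : nat) (b c : R) (k : nat) : (n <= k)%nat -> cesaro_coef n b c k = 0.
Proof. intros H. unfold cesaro_coef. rewrite (proj2 (Nat.ltb_ge k n) H). reflexivity. Qed.

Lemma cesaro_coef_0 (n : nat) (b c : R) : (1 <= n)%nat -> 0 < c <= b -> cesaro_coef n b c 0 = 1.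
Proof.
  intros Hn H. unfold cesaro_coef. rewrite (proj2 (Nat.ltb_lt 0 n)) by lia.
  rewrite Nat.sub_0_r. pose proof (cesaro_B_pos b c (n - 1) H). field. lra.
Qed.

Lemma cesaro_coef_nonneg (n : nat) (b c : R) (k : nat) : 0 < c <= b -> 0 <= cesaro_coef n b c k.
Proof.
  intros H. unfold cesaro_coef. destruct (k <? n)%nat; [| lra].
  apply Rlt_le, Rdiv_lt_0_compat; apply cesaro_B_pos; auto.
Qed.

Lemma cesaro_coef_step (n : nat) (b c : R) (k : nat) : 0 < c <= b -> (k + 3 <= n)%nat ->
  cesaro_coef n b c (S k) * (b + INR n - INR k - 2) = cesaro_coef n b c k * (c + INR n - INR k - 2).
Proof.
  intros H Hk. unfold cesaro_coef.
  rewrite (proj2 (Nat.ltb_lt k n)), (proj2 (Nat.ltb_lt (S k) n)) by lia.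
  replace n with (k + 3 + (n - k - 3))%nat by lia. set (i := (n - k - 3)%nat).
  replace (k + 3 + i - 1 - S k)%nat with (S i) by lia.
  replace (k + 3 + i - 1 - k)%nat with (S (S i)) by lia.
  rewrite !plus_INR. simpl (INR 3).
  pose proof (cesaro_B_SS b c i H) as HB.
  pose proof (cesaro_B_pos b c (k + 3 + i - 1) H) as HN.
  set (d := cesaro_B b c (k + 3 + i - 1)) in *.
  replace (cesaro_B b c (S i) / d * (b + (INR k + (1 + 1 + 1) + INR i) - INR k - 2))
    with (cesaro_B b c (S i) * (b + INR i + 1) / d) by (field; lra).
  rewrite HB. field. lra.
Qed.

Lemma cesaro_coef_last (m : nat) (b c : R) : 0 < c <= b ->
  cesaro_coef (S (S m)) b c (S m) * (1 + b - c) = cesaro_coef (S (S m)) b c m * c.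
Proof.
  intros H. unfold cesaro_coef.
  rewrite (proj2 (Nat.ltb_lt m (S (S m)))), (proj2 (Nat.ltb_lt (S m) (S (S m)))) by lia.
  replace (S (S m) - 1 - S m)%nat with 0%nat by lia.
  replace (S (S m) - 1 - m)%nat with 1%nat by lia.
  pose proof (cesaro_B_1 b c H) as HB.
  pose proof (cesaro_B_pos b c (S (S m) - 1) H) as HN.
  set (d := cesaro_B b c (S (S m) - 1)) in *.
  replace (cesaro_B b c 0 / d * (1 + b - c)) with (cesaro_B b c 0 * (1 + b - c) / d) by (field; lra).
  rewrite HB. field. lra.
Qed.

Lemma cesaro_poly_shifted (n : nat) (b c : R) : (1 <= n)%nat -> 0 < c <= b ->
  cesaro_poly n b c = (fun z => z * real_poly (cesaro_coef n b c) (n - 1) z)%C.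
Proof.
  intros Hn H. apply functional_extensionality. intros z.
  unfold cesaro_poly.
  assert (Hgen : forall M, (M < n)%nat ->
    (z + sum_n_m (fun k => RtoC (cesaro_B b c (n - k) / cesaro_B b c (n - 1)) * z ^ k) 2 (S M)
     = z * real_poly (cesaro_coef n b c) M z)%C).
  { induction M as [|M IH]; intros HM.
    - rewrite sum_n_m_zero by lia. rewrite real_poly_0, cesaro_coef_0 by auto.
      change (z + 0 = z * 1)%C. ring.
    - rewrite sum_n_Sm by lia. specialize (IH ltac:(lia)).
      rewrite real_poly_S, Cmult_plus_distr_l, <- IH.
      unfold cesaro_coef. rewrite (proj2 (Nat.ltb_lt (S M) n)) by lia.
      replace (n - 1 - S M)%nat with (n - S (S M))%nat by lia.
      unfold plus; simpl. ring. }
  specialize (Hgen (n - 1)%nat ltac:(lia)).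
  replace (S (n - 1)) with n in Hgen by lia. exact Hgen.
Qed.

Definition hadamard_coef (n : nat) (gamma b c : R) (k : nat) : R :=
  binomial_coef (2 - 2 * gamma) k * cesaro_coef n b c k.

Lemma hadamard_coef_0 (n : nat) (gamma b c : R) : (1 <= n)%nat -> 0 < c <= b ->
  hadamard_coef n gamma b c 0 = 1.
Proof.
  intros Hn H. unfold hadamard_coef. rewrite cesaro_coef_0 by auto.
  unfold binomial_coef; simpl. field.
Qed.

Lemma hadamard_coef_nonneg (n : nat) (gamma b c : R) (k : nat) :
  0 <= gamma < 1 -> 0 < c <= b -> 0 <= hadamard_coef n gamma b c k.
Proof.
  intros Hg H. apply Rmult_le_pos; [apply Rlt_le, binomial_coef_pos; lra |].
  apply cesaro_coef_nonneg; auto.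
Qed.

Lemma hadamard_coef_out (n : nat) (gamma b c : R) (k : nat) :
  (n <= k)%nat -> hadamard_coef n gamma b c k = 0.
Proof. intros H. unfold hadamard_coef. rewrite cesaro_coef_out by auto. ring. Qed.

(** Converts an inequality in the shape of the hypotheses of the theorem into one
    between consecutive coefficients of [P]; [num / den] is the ratio of the
    consecutive [cesaro_coef]. *)
Lemma hadamard_coef_ratio (n : nat) (gamma b c A1 A0 num den : R) (k : nat) :
  0 <= gamma < 1 -> 0 < c <= b -> 0 < den ->
  cesaro_coef n b c (S k) * den = cesaro_coef n b c k * num ->
  A1 * (INR k + 2 - gamma) * (INR k + 2 - 2 * gamma) * num
    <= A0 * (INR k + 1 - gamma) * (INR k + 1) * den ->
  A1 * ((INR k + 2 - gamma) * hadamard_coef n gamma b c (S k))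
    <= A0 * ((INR k + 1 - gamma) * hadamard_coef n gamma b c k).
Proof.
  intros Hg Hbc Hden Hstep H.
  pose proof (binomial_coef_S (2 - 2 * gamma) k) as HB.
  pose proof (binomial_coef_pos (2 - 2 * gamma) k ltac:(lra)) as HBp.
  pose proof (cesaro_coef_nonneg n b c k Hbc) as Hw.
  pose proof (pos_INR k) as Hk.
  unfold hadamard_coef.
  set (B1 := binomial_coef _ (S k)) in *. set (B0 := binomial_coef _ k) in *.
  set (w1 := cesaro_coef n b c (S k)) in *. set (w0 := cesaro_coef n b c k) in *.
  apply Rmult_le_reg_l with ((INR k + 1) * den); [apply Rmult_lt_0_compat; lra |].
  replace ((INR k + 1) * den * (A1 * ((INR k + 2 - gamma) * (B1 * w1))))
    with (A1 * (INR k + 2 - gamma) * (((INR k + 1) * B1) * (w1 * den))) by ring.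
  rewrite HB, Hstep.
  replace (A1 * (INR k + 2 - gamma) * ((2 - 2 * gamma + INR k) * B0 * (w0 * num)))
    with (B0 * w0 * (A1 * (INR k + 2 - gamma) * (INR k + 2 - 2 * gamma) * num)) by ring.
  replace ((INR k + 1) * den * (A0 * ((INR k + 1 - gamma) * (B0 * w0))))
    with (B0 * w0 * (A0 * (INR k + 1 - gamma) * (INR k + 1) * den)) by ring.
  apply Rmult_le_compat_l; [apply Rmult_le_pos; lra | exact H].
Qed.

(** * Positivity of the quotient, and the theorem *)

(** After the substitutions [t = (2 - gamma) a1 r / (1 - gamma)],
    [s = (3 - gamma) a2 r^2 / (1 - gamma)] and [x = cos (arg z)] this is
    [quotient_quadratic_pos] with [sigma = (1 - gamma) / (2 - gamma)] and
    [tau = (1 - gamma) / (3 - gamma)]. *)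
Lemma three_term_quotient (gamma a1 a2 : R) (z : C) :
  0 <= gamma < 1 -> 0 <= a1 -> 0 <= a2 ->
  (2 - gamma) * a1 <= 1 - gamma -> 7 * ((3 - gamma) * a2) <= 5 * ((2 - gamma) * a1) ->
  disk z ->
  let X := Re z in let Y := Im z in
  0 < ((1 - gamma) + (2 - gamma) * a1 * X + (3 - gamma) * a2 * (X * X - Y * Y))
       * (1 + a1 * X + a2 * (X * X - Y * Y))
    + ((2 - gamma) * a1 * Y + (3 - gamma) * a2 * (2 * X * Y)) * (a1 * Y + a2 * (2 * X * Y)).
Proof.
  intros Hg Ha1 Ha2 H1 H2 Hz X Y.
  assert (Hsq : Cmod z ^ 2 = X ^ 2 + Y ^ 2) by apply Cmod2_alt.
  unfold disk in Hz. pose proof (Cmod_ge_0 z) as Hr. set (r := Cmod z) in *.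
  clearbody X Y r.
  destruct (Req_dec r 0) as [-> | Hr0].
  { assert (X = 0) by nra. assert (Y = 0) by nra. subst. nra. }
  set (x := X / r). set (g := 1 - gamma).
  set (t := (2 - gamma) * a1 * r / g). set (s := (3 - gamma) * a2 * r ^ 2 / g).
  set (sigma := g / (2 - gamma)). set (tau := g / (3 - gamma)).
  assert (Hg0 : 0 < g) by (unfold g; lra).
  assert (Hp1 : 0 <= (2 - gamma) * a1) by (apply Rmult_le_pos; lra).
  assert (Hp2 : 0 <= (3 - gamma) * a2) by (apply Rmult_le_pos; lra).
  assert (Hr2 : 0 < r ^ 2) by (apply pow_lt; lra).
  assert (HF := quotient_quadratic_pos t s x sigma tau).
  replace (_ + _) with (g * (1 + t ^ 2 * sigma + s ^ 2 * tau - s * (1 + tau)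
      + x * t * (1 + sigma + s * (tau + sigma)) + 2 * s * (1 + tau) * x ^ 2)).
  - apply Rmult_lt_0_compat; [exact Hg0 |]. apply HF.
    + split; [apply Rdiv_le_0_compat; [apply Rmult_le_pos |]; lra |].
      apply Rlt_div_l; [lra |]. unfold g. nra.
    + split; [apply Rdiv_le_0_compat; [apply Rmult_le_pos |]; lra |].
      unfold s, t. apply Rle_div_l; [lra |].
      replace (5 / 7 * ((2 - gamma) * a1 * r / g) * g) with (5 / 7 * ((2 - gamma) * a1) * r) by (field; lra).
      assert (r ^ 2 <= r) by nra.
      apply Rle_trans with ((3 - gamma) * a2 * r); [apply Rmult_le_compat_l; lra |].
      apply Rmult_le_compat_r; lra.
    + assert (- r <= X <= r) by nra. unfold x. split; [apply Rle_div_r | apply Rle_div_l]; lra.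
    + unfold sigma, g. split; [apply Rdiv_le_0_compat; lra | apply Rle_div_l; lra].
    + unfold sigma, tau. split.
      * replace (g / (2 - gamma) / 2) with (g * (/ (2 * (2 - gamma)))) by (field; lra).
        apply Rmult_le_compat_l; [lra |]. apply Rinv_le_contravar; lra.
      * replace (2 * (g / (2 - gamma)) / 3) with (g * (/ (3 / 2 * (2 - gamma)))) by (field; lra).
        apply Rmult_le_compat_l; [lra |]. apply Rinv_le_contravar; lra.
  - assert (HX : X = r * x) by (unfold x; field; lra).
    assert (HY : Y * Y = r ^ 2 * (1 - x ^ 2)) by (rewrite HX in Hsq; lra).
    fold g.
    replace (((2 - gamma) * a1 * Y + (3 - gamma) * a2 * (2 * X * Y)) * (a1 * Y + a2 * (2 * X * Y)))
      with (((2 - gamma) * a1 + (3 - gamma) * a2 * (2 * X)) * (a1 + a2 * (2 * X)) * (Y * Y)) by ring.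
    rewrite HY, HX. unfold s, t, sigma, tau. field. unfold g in *. lra.
Qed.

(** The coefficients of [Q] are those of [P] divided by the increasing numbers
    [k + 1 - gamma], so they inherit the weighted monotonicity, and both
    polynomials take values in the first quadrant. *)
Lemma quotient_pos_of_weighted (gamma : R) (V u : nat -> R) (N : nat) (z : C) :
  0 <= gamma < 1 -> regular_weight V -> 0 < u 0%nat -> (forall k, 0 <= u k) ->
  (2 - gamma) * u 1%nat <= (1 - gamma) * u 0%nat ->
  (forall j, V (S j) * ((INR j + 3 - gamma) * u (S (S j)))
             <= V j * ((INR j + 2 - gamma) * u (S j))) ->
  disk z -> 0 <= Im z ->
  let P := real_poly (fun k => (INR k + 1 - gamma) * u k) N z in
  let Q := real_poly u N z in
  0 < Re P * Re Q + Im P * Im Q.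
Proof.
  intros Hg HV Hu0 Hu H1 Hdec Hz Him P Q.
  assert (HVpos : forall j, 0 < V j).
  { intros j. destruct HV as (_ & Hge & _). specialize (Hge j). pose proof (pos_INR j). lra. }
  destruct (real_poly_first_quadrant V (fun k => (INR k + 1 - gamma) * u k) N z) as [HP1 HP2]; auto.
  - split.
    + intros j. apply Rmult_le_pos; [pose proof (pos_INR (S j)); lra | auto].
    + intros j. specialize (Hdec j). rewrite !S_INR in *.
      replace (INR j + 1 + 1 + 1 - gamma) with (INR j + 3 - gamma) by ring.
      replace (INR j + 1 + 1 - gamma) with (INR j + 2 - gamma) by ring. exact Hdec.
  - simpl INR. apply Rmult_lt_0_compat; lra.
  - simpl INR. lra.
  - destruct (real_poly_first_quadrant V u N z) as [HQ1 HQ2]; auto.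
    + split; [auto |]. intros j. specialize (Hdec j).
      pose proof (Hu (S (S j))). pose proof (Hu (S j)). pose proof (pos_INR j).
      pose proof (HVpos (S j)). pose proof (HVpos j).
      apply Rmult_le_reg_l with (INR j + 3 - gamma); [lra |].
      assert (0 <= V j * u (S j)) by (apply Rmult_le_pos; lra). lra.
    + pose proof (Hu 1%nat). nra.
    + assert (0 < Re P * Re Q) by (apply Rmult_lt_0_compat; assumption).
      assert (0 <= Im P * Im Q) by (apply Rmult_le_pos; assumption). lra.
Qed.

Theorem theorem3p4 (n : nat) (gamma b c lambda mu alpha beta : R)
  (hn : (1 <= n)%nat)
  (hgamma : 0 <= gamma < 1)
  (hbc : b >= c) (hc : c > 0)
  (hlambda : 0 <= lambda) (hmu : 0 <= mu)
  (hlm : 1 <= lambda + mu < 2)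
  (halpha : 0 <= alpha <= 6 / (lambda + 4))
  (hbeta : 0 <= beta <= 6 / (mu + 4))
  (h1 : 2 * (2 - gamma) * (c + INR n - 2) <= b + INR n - 2)
  (h2 : rpow (2 + alpha) lambda * rpow (2 + beta) mu
          * (3 - gamma) * (3 - 2 * gamma) * (c + INR n - 3)
        <= 2 * (2 - gamma) * (b + INR n - 3))
  (h3 : forall k : nat, (2 <= k)%nat -> (k + 3 <= n)%nat ->
        rpow (INR k + 1 + alpha) lambda * rpow (INR k + 1 + beta) mu
          * (INR k + 2 - gamma) * (INR k + 2 - 2 * gamma)
          * (c + INR n - INR k - 2)
        <= rpow (INR k + alpha) lambda * rpow (INR k + beta) mu
          * (INR k + 1 - gamma) * (INR k + 1)
          * (b + INR n - INR k - 2))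
  (h4 : rpow (INR n - 1 + alpha) lambda * rpow (INR n - 1 + beta) mu
          * (INR n - gamma) * (INR n - 2 * gamma) * c
        <= rpow (INR n - 2 + alpha) lambda * rpow (INR n - 2 + beta) mu
          * (INR n - 1 - gamma) * (INR n - 1) * (1 + b - c)) :
  prestarlike gamma (cesaro_poly n b c).
Proof.
  assert (Hbc : 0 < c <= b) by lra.
  destruct (normalized_exponents lambda mu hlambda hmu ltac:(lra)) as (Hl' & Hm' & Hlm').
  set (a := hadamard_coef n gamma b c).
  assert (Ha0 : a 0%nat = 1) by (apply hadamard_coef_0; auto).
  assert (Hann : forall k, 0 <= a k) by (intros k; apply hadamard_coef_nonneg; auto).
  assert (Haout : forall k, (n <= k)%nat -> a k = 0) by (intros k; apply hadamard_coef_out).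
  assert (Hrw : forall k, 1 <= k -> rpow (k + alpha) lambda * rpow (k + beta) mu
      = power_weight alpha beta lambda mu k).
  { intros k Hk. unfold power_weight. rewrite !rpow_pos_eq by lra. reflexivity. }
  (* The inequality p_1 <= p_0.  For n = 2 the ratio of the two coefficients
     involves c / (1 + b - c), which is controlled by h4 and not by h1. *)
  assert (Hfirst : (2 - gamma) * a 1%nat <= (1 - gamma) * a 0%nat).
  { destruct (Nat.le_gt_cases n 1) as [Hn1 | Hn1].
    { rewrite (Haout 1%nat Hn1), Ha0. lra. }
    destruct (Nat.eq_dec n 2) as [Hn2 | Hn2].
    - pose proof (hadamard_coef_ratio n gamma b c 1 1 c (1 + b - c) 0 hgamma Hbc ltac:(lra)) as H.
      rewrite Hn2 in H at 1 2. specialize (H (cesaro_coef_last 0 b c Hbc)).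
      simpl INR in H. unfold a.
      rewrite Hn2 in h4. simpl INR in h4.
      assert (Hw : rpow (1 + 1 - 2 + alpha) lambda * rpow (1 + 1 - 2 + beta) mu
                <= rpow (1 + 1 - 1 + alpha) lambda * rpow (1 + 1 - 1 + beta) mu).
      { apply Rmult_le_compat; try apply rpow_ge_0; apply rpow_le_l; lra. }
      assert (Hpos : 0 < rpow (1 + 1 - 1 + alpha) lambda * rpow (1 + 1 - 1 + beta) mu).
      { rewrite !rpow_pos_eq by lra. apply Rmult_lt_0_compat; apply exp_pos. }
      set (W1 := rpow (1 + 1 - 1 + alpha) lambda * rpow (1 + 1 - 1 + beta) mu) in *.
      set (W0 := rpow (1 + 1 - 2 + alpha) lambda * rpow (1 + 1 - 2 + beta) mu) in *.
      assert (Hkey : (2 - gamma) * (2 - 2 * gamma) * c <= (1 - gamma) * (1 + b - c)).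
      { apply Rmult_le_reg_l with W1; [exact Hpos |].
        assert (W0 * ((1 - gamma) * (1 + b - c)) <= W1 * ((1 - gamma) * (1 + b - c))).
        { apply Rmult_le_compat_r; [apply Rmult_le_pos; lra | exact Hw]. }
        lra. }
      specialize (H ltac:(lra)). lra.
    - pose proof (cesaro_coef_step n b c 0 Hbc ltac:(lia)) as Hstep.
      assert (Hn3 : 3 <= INR n) by (replace 3 with (INR 3) by (simpl; ring); apply le_INR; lia).
      pose proof (hadamard_coef_ratio n gamma b c 1 1 (c + INR n - INR 0 - 2)
        (b + INR n - INR 0 - 2) 0 hgamma Hbc ltac:(simpl INR; lra) Hstep) as H.
      simpl INR in H. unfold a.
      assert (0 <= (1 - gamma) * (b + INR n - 2 - 2 * (2 - gamma) * (c + INR n - 2)))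
        by (apply Rmult_le_pos; lra).
      specialize (H ltac:(lra)). lra. }
  assert (Hstar : starlike gamma (fun z => z * real_poly a (n - 1) z)%C).
  { apply real_poly_starlike; auto. intros z Hz Him.
    destruct (Nat.eq_dec n 3) as [Hn3 | Hn3].
    (* The ratio of the weights at 1 and 2 is at most (5/7)^(lambda + mu),
         as (1 + alpha) / (2 + alpha) <= 5/7 for alpha <= 3/2. *)
    - assert (Hsecond : 7 * ((3 - gamma) * a 2%nat) <= 5 * ((2 - gamma) * a 1%nat)).
      { pose proof (hadamard_coef_ratio n gamma b c 7 5 c (1 + b - c) 1 hgamma Hbc ltac:(lra)) as H.
        rewrite Hn3 in H at 1 2. specialize (H (cesaro_coef_last 1 b c Hbc)).
        simpl INR in H. unfold a.
        rewrite Hn3 in h4. simpl INR in h4.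
        replace (1 + 1 + 1 - 1) with 2 in h4 by ring.
        replace (1 + 1 + 1 - 2) with 1 in h4 by ring.
        rewrite (Hrw 2), (Hrw 1) in h4 by lra.
        assert (Hbound : forall e l, 0 <= e <= 6 / (l + 4) -> 0 <= l -> e <= 3 / 2).
        { intros e l He Hl. apply Rle_trans with (1 := proj2 He). apply Rle_div_l; lra. }
        pose proof (Hbound _ _ halpha hlambda) as Hal. pose proof (Hbound _ _ hbeta hmu) as Hbe.
        assert (HW : power_weight alpha beta lambda mu 1
             <= 5 / 7 * power_weight alpha beta lambda mu 2).
        { apply Rle_trans with (Rpower (5 / 7) (lambda + mu) * power_weight alpha beta lambda mu 2).
          - rewrite Rpower_plus. unfold power_weight.
            replace (Rpower (5 / 7) lambda * Rpower (5 / 7) mu * (Rpower (2 + alpha) lambda * Rpower (2 + beta) mu))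
              with ((Rpower (5 / 7) lambda * Rpower (2 + alpha) lambda)
                    * (Rpower (5 / 7) mu * Rpower (2 + beta) mu)) by ring.
            rewrite !Rpower_mult_distr by lra.
            apply Rmult_le_compat; try (apply Rlt_le, exp_pos); apply Rle_Rpower_l; lra.
          - apply Rmult_le_compat_r; [apply Rlt_le, power_weight_pos |].
            replace (lambda + mu) with (1 + (lambda + mu - 1)) by ring.
            rewrite Rpower_plus, Rpower_1 by lra.
            assert (Rpower (5 / 7) (lambda + mu - 1) <= 1).
            { apply Rle_trans with (Rpower 1 (lambda + mu - 1)); [apply Rle_Rpower_l; lra |].
              unfold Rpower. rewrite ln_1, Rmult_0_r, exp_0. lra. }
            lra. }
        pose proof (power_weight_pos alpha beta lambda mu 2) as Hpos.
        set (W1 := power_weight alpha beta lambda mu 1) in *.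
        set (W2 := power_weight alpha beta lambda mu 2) in *.
        assert (Hkey : 7 * ((3 - gamma) * (3 - 2 * gamma) * c) <= 5 * ((2 - gamma) * 2 * (1 + b - c))).
        { apply Rmult_le_reg_l with W2; [exact Hpos |].
          assert (W1 * ((2 - gamma) * 2 * (1 + b - c)) <= 5 / 7 * W2 * ((2 - gamma) * 2 * (1 + b - c))).
          { apply Rmult_le_compat_r; [| exact HW]. repeat apply Rmult_le_pos; lra. }
          lra. }
        specialize (H ltac:(lra)). lra. }
      rewrite Hn3. simpl (3 - 1)%nat.
      pose proof (three_term_quotient gamma (a 1%nat) (a 2%nat) z hgamma (Hann _) (Hann _)
        ltac:(rewrite Ha0 in Hfirst; lra) Hsecond Hz) as H.
      cbv zeta in *. clear - H Ha0.
      unfold real_poly. destruct z as [x y].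
      unfold Re, Im in *. cbn [fst snd sum_f_R0 Cpow] in *.
      unfold Cmult, RtoC in *. cbn [fst snd] in *. rewrite Ha0. simpl INR.
      match goal with |- 0 < ?e => match type of H with 0 < ?f => replace e with f by ring end end.
      exact H.
    - apply (quotient_pos_of_weighted gamma (normalized_weight alpha beta lambda mu)); auto.
      + apply normalized_weight_regular; lra.
      + rewrite Ha0. lra.
      + intros j.
        destruct (Nat.le_gt_cases n (S (S j))) as [Hout | Hin].
        { rewrite (Haout _ Hout). rewrite !Rmult_0_r.
          pose proof (pos_INR j).
          apply Rmult_le_pos; [| apply Rmult_le_pos; [lra | auto]].
          destruct j; cbn [normalized_weight]; [lra | apply Rlt_le, power_weight_pos]. }
        assert (Hrest : 0 <= (INR j + 2 - gamma) * a (S j)).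
        { pose proof (pos_INR j). apply Rmult_le_pos; [lra | auto]. }
        destruct j as [|j].
        * assert (Hn4 : 4 <= INR n) by (replace 4 with (INR 4) by (simpl; ring); apply le_INR; lia).
          (* Frequency 2 against frequency 1: the weight of the latter is 1. *)
          rewrite (Hrw 2) in h2 by lra.
          pose proof (hadamard_coef_ratio n gamma b c (power_weight alpha beta lambda mu 2) 1
            (c + INR n - INR 1 - 2) (b + INR n - INR 1 - 2) 1
            hgamma Hbc ltac:(simpl INR; lra) (cesaro_coef_step n b c 1 Hbc ltac:(lia))) as H.
          simpl INR in H. specialize (H ltac:(lra)).
          cbn [normalized_weight]. simpl INR.
          pose proof (power_weight_le_exponents alpha beta lambda mu (lambda / (lambda + mu))
            (mu / (lambda + mu)) (1 + 1) ltac:(lra) ltac:(lra) ltac:(lra) ltac:(lra) ltac:(lra)) as Hle.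
          replace (1 + 1) with 2 in * by ring.
          assert (0 <= (3 - gamma) * a 2%nat) by (apply Rmult_le_pos; [lra | auto]).
          replace (0 + 3 - gamma) with (3 - gamma) by ring.
          replace (0 + 2 - gamma) with (2 - gamma) by ring.
          fold a in H.
          apply Rle_trans with (power_weight alpha beta lambda mu 2 * ((3 - gamma) * a 2%nat)).
          -- apply Rmult_le_compat_r; lra.
          -- lra.
        * cbn [normalized_weight].
          pose proof (pos_INR j) as Hj.
          apply (power_weight_transfer alpha beta lambda mu); try lra.
          { rewrite !S_INR. lra. }
          set (k := S (S j)) in *.
          replace (INR (S j) + 1) with (INR k) by (unfold k; rewrite (S_INR (S j)); ring).
          replace (INR (S j) + 3 - gamma) with (INR k + 2 - gamma) by (unfold k; rewrite (S_INR (S j)); ring).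
          replace (INR (S j) + 2 - gamma) with (INR k + 1 - gamma) by (unfold k; rewrite (S_INR (S j)); ring).
          assert (Hk2 : 2 <= INR k) by (unfold k; rewrite !S_INR; lra).
          destruct (Nat.eq_dec n (S (S k))) as [Hlast | Hnlast].
          -- apply (hadamard_coef_ratio n gamma b c _ _ c (1 + b - c) k); auto; [lra | |].
             ++ rewrite Hlast. apply cesaro_coef_last; auto.
             ++ rewrite Hlast, !S_INR in h4.
                replace (INR k + 1 + 1 - 1) with (INR k + 1) in h4 by ring.
                replace (INR k + 1 + 1 - 2) with (INR k) in h4 by ring.
                rewrite (Hrw (INR k + 1)), (Hrw (INR k)) in h4 by lra.
                lra.
          -- assert (Hkn : (k + 3 <= n)%nat) by lia.
             specialize (h3 k ltac:(unfold k; lia) Hkn).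
             rewrite (Hrw (INR k + 1)), (Hrw (INR k)) in h3 by lra.
             assert (INR k + 3 <= INR n).
             { apply le_INR in Hkn. rewrite plus_INR in Hkn. simpl (INR 3) in Hkn. lra. }
             apply (hadamard_coef_ratio n gamma b c _ _ (c + INR n - INR k - 2) (b + INR n - INR k - 2) k);
               auto; [lra | apply cesaro_coef_step; auto]. }
  rewrite cesaro_poly_shifted by auto.
  split; [apply shifted_poly_class_A0, cesaro_coef_0; auto |].
  exists (fun z => z * real_poly a (n - 1) z)%C. split; [| exact Hstar].
  exists (fun k => match k with O => RtoC 0
                   | S j => RtoC (binomial_coef (2 - 2 * gamma) j) end).
  exists (fun k => match k with O => RtoC 0 | S j => RtoC (cesaro_coef n b c j) end).
  split; [apply koebe_expansion; auto | split].
  - apply shifted_poly_expansion. intros k Hk. apply cesaro_coef_out. lia.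
  - intros z Hz.
    eapply is_pseries_ext; [| apply (shifted_poly_expansion a (n - 1)); [| exact Hz]].
    + intros [|k]; [rewrite Cmult_0_l; reflexivity |].
      unfold a, hadamard_coef. rewrite RtoC_mult. reflexivity.
    + intros k Hk. apply Haout. lia.
Qed.
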